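(* Gal's conjecture holds for the generalized associahedra of type $D$: for every integer $n\ge 2$ and every $0\le i\le [n/2]$, one has $\gamma_i(D^n)\geq 0$.
   Context: A convex polytope of dimension $n$ is simple if each of its vertices is contained in precisely $n$ facets. A simple polytope is called flag if any set of pairwise intersecting facets has a non-empty common intersection; the combinatorial type of a flag polytope is determined by which pairs of its facets intersect. The $\gamma$-polynomial: for an $n$-dimensional polytope $P$ let $f_i$ be the number of its $i$-dimensional faces (so $f_n=1$), and set $f(P)(t)=\sum_{i=0}^n f_i t^i$ and $h(P)(t)=f(P)(t-1)$. For a simple polytope, the Dehn–Sommerville equations say that $h(P)$ is reciprocal (palindromic), so there are unique numbers $\gamma_i=\gamma_i(P)$ with $$h(P)(t)=\sum_{i=0}^{[n/2]}\gamma_i t^i(1+t)^{n-2i}.$$ Gal's conjecture states that $\gamma_i(P)\ge 0$ for all $i$ for every flag polytope $P$. The polytope $D^n$: the generalized associahedron $D^n$ is the $n$-dimensional simple flag polytope dual to the cluster complex of the finite type cluster algebra with Dynkin diagram $D_n$ (with the conventions $D_2=A_1\sqcup A_1$, $D_3=A_3$). Combinatorially it is described as follows. Take a regular $2n$-gon. The set of facets of $D^n$ is in bijection with $Diag \cup D \cup D'$ (disjoint union), where $Diag$ is the set of unordered pairs of mutually centrally symmetric diagonals of the $2n$-gon that are not diameters (a diameter is a diagonal joining two antipodal vertices), and $D$ and $D'$ are two copies of the set of the $n$ diameters, those in $D$ coloured in one colour and those in $D'$ in another colour. Two distinct facets intersect if and only if one of the following holds: (1) at least one of the two corresponds to an element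 of $Diag$, and no diagonal belonging to the first facet has a common interior point with a diagonal belonging to the second; (2) they correspond to two diameters of the same colour; (3) they correspond to two diameters of different colours connecting the same pair of antipodal vertices. *)

(* Defs.v *)
From HB Require Import structures.
From mathcomp Require Import all_boot all_order all_algebra finmap.
From mathcomp Require Import boolp classical_sets functions cardinality reals.
From mathcomp Require Import topology normedtype trigo.

Set Implicit Arguments.
Unset Strict Implicit.
Unset Printing Implicit Defensive.

Import Order.TTheory GRing.Theory Num.Theory.
Import numFieldNormedType.Exports.
Local Open Scope classical_set_scope.
Local Open Scope card_scope.
Local Open Scope ring_scope.

Section Polytopes.
Variables (R : realType) (m : nat).
Implicit Types (P F G : set 'rV[R]_m) (k n : nat).

Definition dot (a x : 'rV[R]_m) : R := \sum_j a 0 j * x 0 j.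

(* The ambient dimension m may exceed the dimension of P. *)
Definition polytope P : Prop :=
  bounded_set P /\
  exists (k : nat) (a : 'I_k -> 'rV[R]_m) (b : 'I_k -> R),
    P = [set x | forall i, dot (a i) x <= b i].

(* The smallest affine subspace containing F is x0 + U with \dim U = k; in
   particular the empty set has no dimension. *)
Definition has_dim F k : Prop :=
  exists (x0 : 'rV[R]_m) (U : {vspace 'rV[R]_m}),
    [/\ F x0, \dim U = k, F `<=` [set x | x - x0 \in U] &
        forall V : {vspace 'rV[R]_m},
          F `<=` [set x | x - x0 \in V] -> (U <= V)%VS].

(* Taking c = 0 and d = 0 shows that P is a face of itself; the empty set is
   not counted as a face. *)
Definition face P F : Prop :=
  F !=set0 /\
  exists (c : 'rV[R]_m) (d : R),
    (forall x, P x -> dot c x <= d) /\ F = P `&` [set x | dot c x = d].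

Definition facet P F : Prop :=
  face P F /\ exists k, has_dim P k.+1 /\ has_dim F k.

Definition simple_polytope n P : Prop :=
  [/\ polytope P, has_dim P n &
      forall v, face P [set v] -> [set F | facet P F /\ F v] #= `I_n].

Definition flag_polytope n P : Prop :=
  simple_polytope n P /\
  forall S : set (set 'rV[R]_m),
    S `<=` facet P ->
    (forall F G, S F -> S G -> (F `&` G) !=set0) ->
    (\bigcap_(F in S) F) !=set0.

Definition fnum P (i : nat) : nat :=
  #|` fset_set [set F | face P F /\ has_dim F i] |%fset.

Definition fpoly n P : {poly int} := \sum_(i < n.+1) (fnum P i)%:Z *: 'X^i.

Definition hpoly n P : {poly int} := fpoly n P \Po ('X - 1).

Definition gamma_numbers n P (gamma : {ffun 'I_(n./2).+1 -> int}) : Prop :=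
  hpoly n P =
    \sum_(i < (n./2).+1) gamma i *: ('X^i * (1 + 'X) ^+ (n - i.*2)).

End Polytopes.

Arguments gamma_numbers {R m} n P gamma.

Section Polygon.
Variable n : nat.
Implicit Types d : {set 'I_(n.*2)}.

(* ordS is the cyclic successor, so this is v + n modulo 2n. *)
Definition antipode (v : 'I_(n.*2)) : 'I_(n.*2) := iter n (@ordS n.*2) v.

Definition is_diagonal d : bool :=
  [exists u, exists v,
    [&& d == [set u; v]%SET, u != v, v != ordS u & u != ordS v]].

Definition is_diameter d : bool :=
  is_diagonal d && [exists u, d == [set u; antipode u]%SET].

(* Unordered pairs of mutually centrally symmetric non-diameters. *)
Definition is_diag_pair (e : {set {set 'I_(n.*2)}}) : bool :=
  [exists d : {set 'I_(n.*2)},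
    [&& is_diagonal d, ~~ is_diameter d & e == [set d; antipode @: d]%SET]].

Definition diag_pair : Type := {e : {set {set 'I_(n.*2)}} | is_diag_pair e}.

Definition diameter : Type := {d : {set 'I_(n.*2)} | is_diameter d}.

(* The boolean is the colour: true for D and false for D'. *)
Definition facet_label : Type := (diag_pair + bool * diameter)%type.

Definition diagonals_of (x : facet_label) : {set {set 'I_(n.*2)}} :=
  match x with
  | inl e => val e
  | inr (_, d) => [set val d]%SET
  end.

Variable R : realType.

Definition polygon_vertex (k : 'I_(n.*2)) : R * R :=
  (cos (2 * pi * k%:R / n.*2%:R), sin (2 * pi * k%:R / n.*2%:R)).

Definition diagonal_interior d : set (R * R) :=
  [set p | exists u v t, [/\ d = [set u; v]%SET, u != v, 0 < t < 1 &
     p = (1 - t) *: polygon_vertex u + t *: polygon_vertex v]].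

Definition compatible (x y : facet_label) : Prop :=
  match x, y with
  | inr (c, d), inr (c', d') => c = c' \/ d = d'
  | _, _ => forall d d', d \in diagonals_of x -> d' \in diagonals_of y ->
      diagonal_interior d `&` diagonal_interior d' = set0
  end.

End Polygon.

(* P is (a geometric realization of) the polytope D^n; its combinatorial type
   is determined by the intersection relation between its facets. *)
Definition type_D_associahedron (R : realType) (m n : nat)
    (P : set 'rV[R]_m) : Prop :=
  flag_polytope n P /\
  exists phi : facet_label n -> set 'rV[R]_m,
    [/\ injective phi, range phi = facet P &
        forall x y, x <> y ->
          ((phi x `&` phi y) !=set0 <-> compatible R x y)].

(* Main.v *)
Require Import Defs.
From HB Require Import structures.
From mathcomp Require Import all_boot all_order all_algebra finmap.
From mathcomp Require Import boolp classical_sets functions cardinality reals.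
From mathcomp Require Import topology normedtype trigo.
From mathcomp Require Import ring lra zify.
(* Last, so that the names shared with classical sets denote finite sets. *)
From mathcomp Require Import fintype finset.

Set Implicit Arguments.
Unset Strict Implicit.
Unset Printing Implicit Defensive.

Import Order.TTheory GRing.Theory Num.Theory.
Import numFieldNormedType.Exports.
Local Open Scope ring_scope.

(** The faces of a simple polytope of codimension [k] are the nonempty
    intersections of [k] facets. The polytope being flag, the face numbers of [P]
    therefore count the cliques, by size, of the compatibility graph of the facet
    labels ([fnum_cliques]), and what remains is an enumeration in the [2n]-gon
    followed by an algebraic identity.

    Geometry. The polytope is cut out, in its affine span, by one inequality per
    facet ([facet_representation]). At a vertex the [n] tight forms are independent,
    because their common kernel is trivial and there are as many of them as the
    dimension; hence each set [S] of facets through a vertex meets in a face of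
    codimension [#|S|] contained in no other facet ([has_dim_cell],
    [common_facets_cell]).

    Enumeration. A clique is a noncrossing family [T] of symmetric pairs of
    diagonals, together with coloured diameters among the [c] diameters that [T]
    leaves free. These diameters are either all of one colour, or the two copies of
    one diameter, so they contribute the generating polynomial
    [2 (1 + x)^c - 1 + c x^2] ([sum_bicoloured]). Always [c > 0]
    ([compatible_diameter_exists]), so [T] can be counted once for each free
    diameter, with weight [1 / c]. Once a free diameter is fixed, [T] is seen on one
    side of it as a dissection along the path [0, ..., n], the other free diameters
    being the visible vertices ([frame_sum]). Dissections along a path grow one
    vertex at a time, by joining the new vertex to a set of visible vertices
    ([dissection_sum]); solving the resulting recursion ([iter_transfer]) shows that
    [C(n + k - 1, k) C(n - c - 1, k - 1)] of the families [T] have [k > 0] members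
    and leave [c] diameters free. Summation gives the number [f_k] of cliques of
    size [k] ([clique_count_closed]):
      [(n - 1) f_k = C(n, k) ((n - 1) C(n + k, k) - k C(n + k - 2, k))].

    Algebra. With [Q = (1 + z) (t + z)], expanding powers of
    [Q = (1 + z)^2 + (t - 1) (1 + z)] turns this formula into
      [h(t) = [z^n] Q^n - n / (n - 1) [z^(n - 2)] Q^(n - 1)],
    while expanding powers of [Q = (z^2 + t) + (1 + t) z] exhibits both
    coefficients as combinations of the [t^i (1 + t)^(n - 2 i)]. The result is
      [gamma_i = (n - 1 - i) / (n - 1) * n! / (i! i! (n - 2 i)!)],
    which is nonnegative because [i <= n / 2 <= n - 1]. *)

(** * Faces of a simple polytope *)

Section Polytopes.
Local Open Scope classical_set_scope.

Section Dot.
Variables (R : realType) (m : nat).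
Implicit Types a x y u : 'rV[R]_m.

Lemma dotDr a x y : dot a (x + y) = dot a x + dot a y.
Proof.
by rewrite /dot -big_split; apply: eq_bigr => j _; rewrite mxE mulrDr.
Qed.

Lemma dotZr a k x : dot a (k *: x) = k * dot a x.
Proof. by rewrite /dot mulr_sumr; apply: eq_bigr => j _; rewrite mxE mulrCA. Qed.

Lemma dotNr a x : dot a (- x) = - dot a x.
Proof. by rewrite -scaleN1r dotZr mulN1r. Qed.

Lemma dotBr a x y : dot a (x - y) = dot a x - dot a y.
Proof. by rewrite dotDr dotNr. Qed.

Lemma dot0r a : dot a 0 = 0.
Proof. by rewrite -(scale0r 0) dotZr mul0r. Qed.

Lemma dot_suml (I : finType) (S : {set I}) (a : I -> 'rV[R]_m) x :
  dot (\sum_(i in S) a i) x = \sum_(i in S) dot (a i) x.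
Proof.
rewrite /dot exchange_big; apply: eq_bigr => j _.
by rewrite summxE mulr_suml.
Qed.

Lemma dot_sumr (I : finType) (S : pred I) a (u : I -> 'rV[R]_m) :
  dot a (\sum_(i | S i) u i) = \sum_(i | S i) dot a (u i).
Proof. by elim/big_rec2: _ => [|i y z _ <-]; rewrite ?dot0r ?dotDr. Qed.

Definition dot_form a (x : 'rV[R]_m) : R^o := dot a x.

Fact dot_form_is_linear a : linear (dot_form a).
Proof. by move=> k x y; rewrite /dot_form dotDr dotZr. Qed.

HB.instance Definition _ a :=
  GRing.isLinear.Build R 'rV[R]_m R^o *:%R (dot_form a) (dot_form_is_linear a).

Definition hyper a : {vspace 'rV[R]_m} := lker (linfun (dot_form a)).

Lemma mem_hyper a u : (u \in hyper a) = (dot a u == 0).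
Proof. by rewrite memv_ker lfunE. Qed.

Lemma dim_cap_hyper (W : {vspace 'rV[R]_m}) a :
  (\dim W <= (\dim (W :&: hyper a)).+1)%N.
Proof.
have := limg_ker_dim (linfun (dot_form a)) W; rewrite -/(hyper a) => <-.
rewrite -[leqRHS]addn1 leq_add2l.
by apply: leq_trans (dimvS (subvf _)) _; rewrite dimvf.
Qed.

Lemma dim_cap_hyper_lt (W : {vspace 'rV[R]_m}) a u :
  u \in W -> dot a u != 0 -> (\dim (W :&: hyper a) < \dim W)%N.
Proof.
move=> uW au; rewrite ltn_neqAle dimvS ?capvSl // andbT.
apply: contra au => /eqP e; rewrite -mem_hyper.
have /eqP eW : (W :&: hyper a)%VS == W by rewrite eqEdim capvSl e leqnn.
by move: uW; rewrite -{1}eW memv_cap => /andP[].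
Qed.

End Dot.

Section Dimension.
Variables (R : realType) (m : nat).
Implicit Types (F : set 'rV[R]_m) (W U V : {vspace 'rV[R]_m}).

Lemma has_dim_at F k z : has_dim F k -> F z ->
  exists W, [/\ \dim W = k, F `<=` [set x | x - z \in W] &
    forall V, F `<=` [set x | x - z \in V] -> (W <= V)%VS].
Proof.
move=> [x0 [U [F0 dU FU minU]]] Fz; exists U; split => // [x Fx|V FV] /=.
  rewrite (_ : x - z = (x - x0) - (z - x0)); last by rewrite opprB addrA subrK.
  by rewrite rpredB // FU.
apply: minU => x Fx /=.
rewrite (_ : x - x0 = (x - z) - (x0 - z)); last by rewrite opprB addrA subrK.
by rewrite rpredB //; exact: FV.
Qed.

Lemma has_dim_uniq F k l : has_dim F k -> has_dim F l -> k = l.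
Proof.
move=> Fk Fl; have [z [_ [Fz _ _ _]]] := Fk.
have [W [<- FW minW]] := has_dim_at Fk Fz.
have [V [<- FV minV]] := has_dim_at Fl Fz.
by apply/eqP; rewrite eqn_leq !dimvS ?minW ?minV.
Qed.

(** Every dimension below is computed through this criterion: the directions in
    which one can leave [z] inside [F] already span the direction of [F]. *)
Lemma has_dim_absorb F W z : F z -> F `<=` [set x | x - z \in W] ->
  (forall u, u \in W -> exists2 e : R, 0 < e & F (z + e *: u)) ->
  has_dim F (\dim W).
Proof.
move=> Fz FW absorb; exists z, W; split => // V FV; apply/subvP => u uW.
have [e e0 /FV /=] := absorb u uW.
by rewrite addrC addKr => /(rpredZ e^-1); rewrite scalerA mulVf ?scale1r ?gt_eqF.
Qed.

End Dimension.

Section LinearSystem.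
Variables (R : realType) (m : nat) (I : finType).
Variables (a : I -> 'rV[R]_m) (b : I -> R).

Lemma strict_move (S : {set I}) (z u : 'rV[R]_m) :
    (forall i, i \in S -> dot (a i) z < b i) ->
  exists2 e : R, 0 < e &
    forall t, 0 <= t <= e -> forall i, i \in S -> dot (a i) (z + t *: u) < b i.
Proof.
move=> hz; have step (s : seq I) : {subset s <= S} -> exists2 e : R, 0 < e &
    forall t, 0 <= t <= e -> forall i, i \in s -> dot (a i) (z + t *: u) < b i.
  elim: s => [|i s IH] sS; first by exists 1.
  have [|e e0 he] := IH; first by move=> j js; apply: sS; rewrite inE js orbT.
  have zi := hz i (sS i (mem_head _ _)).
  pose d := `|dot (a i) u| + 1; have d0 : 0 < d by rewrite ltr_wpDl.
  pose e' := (b i - dot (a i) z) / d.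
  have e'0 : 0 < e' by rewrite divr_gt0 // subr_gt0.
  exists (Num.min e e') => [|t /andP[t0 te] j]; first by rewrite lt_min e0 e'0.
  move: te; rewrite le_min => /andP[te te']; rewrite inE => /orP[/eqP->|js].
    rewrite dotDr dotZr -ltrBrDl.
    have [->|tn0] := eqVneq t 0; first by rewrite mul0r subr_gt0.
    have tp : 0 < t by rewrite lt_neqAle eq_sym tn0.
    apply: (@lt_le_trans _ _ (t * d)); last by rewrite -ler_pdivlMr.
    by rewrite ltr_pM2l // (le_lt_trans (ler_norm _)) // /d ltrDl.
  by apply: he js; rewrite t0.
have [|e e0 he] := step (enum S); first by move=> i; rewrite mem_enum.
by exists e => // t ht i iS; apply: he; rewrite ?mem_enum.
Qed.

(** Constraints that are each slack somewhere on a convex set are simultaneously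
    slack at an average of the witnesses. *)
Lemma common_slack (F : set 'rV[R]_m) (S : {set I}) : F !=set0 ->
    (forall x y, F x -> F y -> F (2^-1 *: (x + y))) ->
    (forall i x, i \in S -> F x -> dot (a i) x <= b i) ->
    (forall i, i \in S -> exists2 x, F x & dot (a i) x < b i) ->
  exists2 y, F y & forall i, i \in S -> dot (a i) y < b i.
Proof.
move=> [x0 F0] mid val slack.
have step (s : seq I) : {subset s <= S} ->
    exists2 y, F y & forall i, i \in s -> dot (a i) y < b i.
  elim: s => [|i s IH] sS; first by exists x0.
  have [|y Fy hy] := IH; first by move=> j js; apply: sS; rewrite inE js orbT.
  have iS : i \in S by apply: sS; rewrite mem_head.
  have [x Fx hx] := slack i iS.
  exists (2^-1 *: (x + y)) => [|j]; first exact: mid.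
  rewrite inE dotZr dotDr => /orP[/eqP->|js].
    by have := val _ _ iS Fy; lra.
  have jS : j \in S by apply: sS; rewrite inE js orbT.
  by have := val _ _ jS Fx; have := hy _ js; lra.
have [|y Fy hy] := step (enum S); first by move=> i; rewrite mem_enum.
by exists y => // i iS; apply: hy; rewrite mem_enum.
Qed.

End LinearSystem.

Section FacetSystem.
Variables (R : realType) (m n : nat) (P : set 'rV[R]_m) (I : finType).
Variables (x0 : 'rV[R]_m) (U : {vspace 'rV[R]_m}).
Variables (a : I -> 'rV[R]_m) (b : I -> R).
Hypothesis dimU : \dim U = n.
Hypothesis PE : P = [set x | x - x0 \in U /\ forall i, dot (a i) x <= b i].
Implicit Types (S : {set I}) (x y z u v : 'rV[R]_m).

Definition cell S : set 'rV[R]_m :=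
  P `&` [set x | forall i, i \in S -> dot (a i) x = b i].

Definition tight x : {set I} := [set i | dot (a i) x == b i]%SET.

Definition common_facets (F : set 'rV[R]_m) : {set I} :=
  [set i | `[< F `<=` [set x | dot (a i) x = b i] >]]%SET.

(** When [P] is simple and [cell S] is nonempty, the direction of the affine span
    of [cell S]. *)
Definition directions S : {vspace 'rV[R]_m} :=
  (U :&: \bigcap_(i in S) hyper (a i))%VS.

Lemma directionsP S u :
  reflect (u \in U /\ forall i, i \in S -> dot (a i) u = 0) (u \in directions S).
Proof.
rewrite memv_cap memvE; apply: (iffP andP) => -[uU h]; split => //.
  by move/subv_bigcapP: h => h i /h; rewrite -memvE mem_hyper => /eqP.
by apply/subv_bigcapP => i /h e; rewrite -memvE mem_hyper e.
Qed.

Lemma member_le x i : P x -> dot (a i) x <= b i.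
Proof. by rewrite PE => -[]. Qed.

Lemma member_affine x : P x -> x - x0 \in U.
Proof. by rewrite PE => -[]. Qed.

Lemma member_diff x y : P x -> P y -> x - y \in U.
Proof.
move=> /member_affine hx /member_affine hy.
rewrite (_ : x - y = (x - x0) - (y - x0)); last by rewrite opprB addrA subrK.
exact: rpredB.
Qed.

Lemma member_move x u (t : R) : P x -> u \in U ->
  (forall i, dot (a i) (x + t *: u) <= b i) -> P (x + t *: u).
Proof.
move=> /member_affine hx uU h; rewrite PE; split => //.
by rewrite addrAC rpredD // rpredZ.
Qed.

Lemma member_mid x y : P x -> P y -> P (2^-1 *: (x + y)).
Proof.
move=> hx hy; rewrite PE; split => [|i].
  rewrite (_ : _ - x0 = 2^-1 *: ((x - x0) + (y - x0))).
    by rewrite rpredZ // rpredD ?member_affine.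
  by apply/rowP => j; rewrite !mxE; lra.
by have := member_le i hx; have := member_le i hy; rewrite dotZr dotDr; lra.
Qed.

Lemma member_nbhs x u : P x -> u \in directions (tight x) ->
  exists2 e : R, 0 < e & forall t, `|t| <= e -> P (x + t *: u).
Proof.
move=> hx /directionsP[uU hu].
have slack i : i \in ~: tight x -> dot (a i) x < b i.
  by rewrite !inE lt_neqAle member_le // andbT.
have [e e0 he] := strict_move u slack.
have [e' e'0 he'] := strict_move (- u) slack.
exists (Num.min e e') => [|t]; first by rewrite lt_min e0 e'0.
rewrite le_min => /andP[te te']; apply: member_move => // i.
have [it|it] := boolP (i \in tight x).
  by rewrite dotDr dotZr hu // mulr0 addr0 member_le.
have [t0|t0] := leP 0 t.
  apply: ltW; apply: he; last by rewrite inE.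
  by rewrite t0 -(ger0_norm t0).
rewrite -[t]opprK scaleNr -scalerN; apply: ltW; apply: he'; last by rewrite inE.
by rewrite oppr_ge0 ltW // -(ltr0_norm t0).
Qed.

(** The sum of the inequalities indexed by [S] exposes the cell. *)
Lemma cell_face S : cell S !=set0 -> face P (cell S).
Proof.
move=> ne; split => //.
have sum_le x : P x -> dot (\sum_(i in S) a i) x <= \sum_(i in S) b i.
  by move=> hx; rewrite dot_suml ler_sum // => i _; exact: member_le.
exists (\sum_(i in S) a i), (\sum_(i in S) b i); split => //.
apply/seteqP; split => x [hx h]; split => //=.
  by rewrite dot_suml; apply: eq_bigr.
move=> i iS; apply/eqP; rewrite -subr_eq0 -oppr_eq0 opprB.
have : \sum_(i in S) (b i - dot (a i) x) == 0.
  by rewrite sumrB -dot_suml h subrr.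
rewrite psumr_eq0 => [/allP/(_ i)|j _]; last by rewrite subr_ge0 member_le.
by rewrite mem_index_enum iS; apply.
Qed.

(** From a point [y] of the face off all the facets that miss part of it, the
    segment towards any other point of the cell extends slightly beyond [y]
    inside [P], so the linear form exposing the face is constant on it. *)
Lemma face_cell (F : set 'rV[R]_m) : face P F -> F = cell (common_facets F).
Proof.
move=> [ne [c [d [cle FE]]]]; apply/seteqP; split => [x Fx|x [hx h]].
  split=> [|i]; first by move: Fx; rewrite FE => -[].
  by rewrite inE => /asboolP; apply.
have FP y : F y -> P y by rewrite FE => -[].
have [| | |y Fy hy] := @common_slack _ _ _ a b F (~: common_facets F) ne.
- move=> z w; rewrite !FE => -[hz hz'] [hw hw']; split; first exact: member_mid.
  by rewrite /= dotZr dotDr hz' hw'; lra.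
- by move=> i z _ /FP; exact: member_le.
- move=> i; rewrite !inE => /asboolPn nsub; apply: contrapT => nex; apply: nsub.
  move=> z Fz /=; apply/eqP; rewrite eq_le (member_le i (FP _ Fz)) /= leNgt; apply/negP => lt.
  by apply: nex; exists z.
have [e e0 he] := strict_move (y - x) hy.
have Pz : P (y + e *: (y - x)).
  apply: member_move; [exact: FP | by apply: member_diff => //; exact: FP | move=> i].
  have [iF|iF] := boolP (i \in common_facets F); last first.
    by apply: ltW; apply: he; rewrite ?lexx ?ltW // inE.
  rewrite dotDr dotZr dotBr h // (_ : dot (a i) y = b i) ?subrr ?mulr0 ?addr0 //.
  by move: iF; rewrite inE => /asboolP; apply.
have cy : dot c y = d by move: Fy; rewrite FE => -[].
have := cle _ Pz; rewrite dotDr dotZr dotBr cy gerDl pmulr_rle0 // subr_le0 => dx.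
by rewrite FE; split => //=; apply/eqP; rewrite eq_le cle.
Qed.

Lemma dim_directionsU1 S i : (\dim (directions S) <= (\dim (directions (i |: S))).+1)%N.
Proof.
apply: leq_trans (dim_cap_hyper _ (a i)) _; rewrite ltnS; apply: dimvS.
apply/subvP => u; rewrite memv_cap mem_hyper => /andP[/directionsP[uU h] /eqP ui].
by apply/directionsP; split => // j; rewrite !inE => /orP[/eqP->//|/h].
Qed.

Lemma dim_directionsU S T :
  (\dim (directions S) <= \dim (directions (S :|: T)%SET) + #|T|)%N.
Proof.
move: {2}#|T| (erefl #|T|) => k; elim: k T => [|k IH] T cT.
  have -> : T = finset.set0 by apply/eqP; rewrite -cards_eq0 cT.
  by rewrite finset.setU0 leq_addr.
have [i iT] : exists i, i \in T by apply/set0Pn; rewrite -cards_eq0 cT.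
have cT' : #|(T :\ i)%SET| = k by move: cT; rewrite (cardsD1 i) iT => -[].
apply: leq_trans (IH _ cT') _.
rewrite cT' cT addnS -addSn leq_add2r.
by apply: leq_trans (dim_directionsU1 _ i) _; rewrite finset.setUCA finset.setD1K.
Qed.

Section Vertex.
Hypothesis Pbnd : forall x u : 'rV[R]_m,
  P x -> (forall t, 0 <= t -> P (x + t *: u)) -> u = 0.

Lemma tight_extreme v : P v -> directions (tight v) = 0%VS -> face P [set v].
Proof.
move=> hv d0; have vt : cell (tight v) = [set v].
  apply/seteqP; split => [z [hz h]|z ->]; last first.
    by split => // i; rewrite inE => /eqP.
  apply/eqP; rewrite -subr_eq0 -memv0 -d0; apply/directionsP.
  split; first exact: member_diff.
  by move=> i it; rewrite dotBr h //; move: it; rewrite inE => /eqP ->; rewrite subrr.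
by rewrite -vt; apply: cell_face; rewrite vt; exists v.
Qed.

Lemma extreme_tight v : face P [set v] -> directions (tight v) = 0%VS.
Proof.
move=> [_ [c [d [cle vE]]]].
have [hv cv] : (P `&` [set x | dot c x = d]) v by rewrite -vE.
apply/eqP; rewrite -subv0; apply/subvP => u uD.
have [e e0 he] := member_nbhs hv uD.
have hp : P (v + e *: u) by apply: he; rewrite gtr0_norm.
have hm : P (v + (- e) *: u) by apply: he; rewrite normrN gtr0_norm.
have : [set v] (v + e *: u).
  rewrite vE; split => //=; apply/eqP; rewrite eq_le cle //=.
  by have := cle _ hm; rewrite !dotDr !dotZr cv; lra.
move=> /= /eqP; rewrite addrC -subr_eq0 addrK scaler_eq0 gt_eqF //= => /eqP->.
exact: mem0v.
Qed.

(** Moving along a direction tangent to all tight constraints, a bounded [P]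
    is left through a new one. *)
Lemma more_tight x u : P x -> u \in directions (tight x) -> u != 0 ->
  exists2 y, P y & tight x \proper tight y.
Proof.
move=> hx uD un0; have [uU hu] := directionsP _ _ uD.
pose Q := [set i | 0 < dot (a i) u]%SET.
pose q i := (b i - dot (a i) x) / dot (a i) u.
have [i0 i0Q] : exists i, i \in Q.
  apply: contrapT => nex; apply: (negP un0); apply/eqP; apply: (Pbnd hx) => t t0.
  apply: member_move => // i; rewrite dotDr dotZr.
  apply: (@le_trans _ _ (dot (a i) x)); last exact: member_le.
  rewrite gerDl mulr_ge0_le0 // leNgt; apply/negP => iQ; apply: nex.
  by exists i; rewrite inE.
pose i := [arg min_(j < i0 in Q) q j]%O.
have [iQ imin] : i \in Q /\ forall j, j \in Q -> q i <= q j.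
  by rewrite /i; case: arg_minP.
have ui : 0 < dot (a i) u by move: iQ; rewrite inE.
have q0 : 0 <= q i by rewrite divr_ge0 ?subr_ge0 ?member_le // ltW.
have eqi : dot (a i) (x + q i *: u) = b i.
  by rewrite dotDr dotZr /q divfK ?gt_eqF // addrC subrK.
exists (x + q i *: u).
  apply: member_move => // j; rewrite dotDr dotZr.
  have [uj|uj] := ltP 0 (dot (a j) u).
    rewrite -lerBrDl -ler_pdivlMr //; apply: imin; by rewrite inE.
  apply: (@le_trans _ _ (dot (a j) x)); last exact: member_le.
  by rewrite gerDl mulr_ge0_le0.
apply/properP; split.
  apply/fintype.subsetP => j jt; rewrite inE dotDr dotZr hu // mulr0 addr0.
  by move: jt; rewrite inE.
exists i; first by rewrite inE eqi.
by apply/negP => /hu e; move: ui; rewrite e ltxx.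
Qed.

(** A point of the cell with as many tight constraints as possible is a vertex. *)
Lemma cell_vertex S : cell S !=set0 -> exists2 v, face P [set v] & S \subset tight v.
Proof.
move=> [x [hx h]].
have Sx : S \subset tight x by apply/fintype.subsetP => i /h e; rewrite inE e.
move: {2}(#|I| - #|tight x|)%N (leqnn (#|I| - #|tight x|)%N) => k.
elim: k x hx Sx {h} => [|k IH] x hx Sx le.
  have tT : tight x = [set: I]%SET.
    apply/eqP; rewrite eqEcard finset.subsetT cardsT /=.
    by move: le; rewrite leqn0 subn_eq0.
  exists x => //; apply: tight_extreme => //; apply/eqP; rewrite -subv0.
  apply/subvP => u uD; have [->|un0] := eqVneq u 0; first exact: mem0v.
  have [y _ /properP[_ [i _]]] := more_tight hx uD un0.
  by rewrite tT inE.
have [d0|dn0] := eqVneq (directions (tight x)) 0%VS.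
  by exists x => //; exact: tight_extreme.
have un0 : vpick (directions (tight x)) != 0 by rewrite vpick0.
have [y hy ty] := more_tight hx (memv_pick _) un0.
apply: (IH y) => //; first by apply: fintype.subset_trans Sx (proper_sub ty).
rewrite leq_subLR; move: le; rewrite leq_subLR => /leq_trans; apply.
by rewrite addnS -addSn leq_add2r proper_card.
Qed.

Hypothesis simpleP : forall v, face P [set v] -> #|tight v| = n.

(** At a vertex [v] on [n] facets the [n] tight forms have no common zero in
    [U]; intersecting [U] with their kernels one at a time, the dimension must
    then drop by exactly one at each step. *)
Lemma dim_directions v S : face P [set v] -> S \subset tight v ->
  \dim (directions S) = (n - #|S|)%N.
Proof.
move=> fv St; have [cv d0] := (simpleP fv, extreme_tight fv).
have lo := dim_directionsU finset.set0 S; have := dim_directionsU S (tight v :\: S).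
rewrite finset.setDE finset.setUIr finset.setUCr finset.setIT (finset.setUidPr St) d0 dimv0 add0n.
rewrite -finset.setDE cardsDS // cv => hi; apply/eqP; rewrite eqn_leq hi leq_subLR /=.
move: lo; rewrite finset.set0U addnC; apply: leq_trans.
rewrite -{1}dimU; apply: dimvS; apply/subvP => u uU; apply/directionsP.
by split => // i; rewrite inE.
Qed.

(** Directions pushing [v] off exactly the tight facets outside [S]. *)
Lemma release v S : face P [set v] -> S \subset tight v ->
  exists2 u, u \in directions S &
    forall i, i \in tight v -> i \notin S -> dot (a i) u < 0.
Proof.
move=> fv St.
have ex i : i \in tight v -> exists u, u \in directions (tight v :\ i) /\ dot (a i) u = -1.
  move=> it; have d1 : \dim (directions (tight v :\ i)) = 1%N.
    rewrite (dim_directions fv) ?subsetDl // -(simpleP fv) (cardsD1 i) it.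
    by rewrite add1n subSnn.
  set w := vpick (directions (tight v :\ i)).
  have wD : w \in directions (tight v :\ i) by exact: memv_pick.
  have wn0 : w != 0 by rewrite vpick0 -dimv_eq0 d1.
  have [wU hw] := directionsP _ _ wD.
  have wi : dot (a i) w != 0.
    apply: contra wn0 => /eqP wi; rewrite -memv0 -(extreme_tight fv).
    apply/directionsP; split => // j jt; have [->//|ji] := eqVneq j i.
    by apply: hw; rewrite !inE ji; move: jt; rewrite inE.
  exists (- (dot (a i) w)^-1 *: w); split; first exact: rpredZ.
  by rewrite dotZr mulNr mulVf.
have [f hf] : exists f : I -> 'rV[R]_m, forall i, i \in tight v ->
    f i \in directions (tight v :\ i) /\ dot (a i) (f i) = -1.
  have : forall i, exists u, i \in tight v ->
      u \in directions (tight v :\ i) /\ dot (a i) u = -1.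
    move=> i; have [it|] := boolP (i \in tight v); last by exists 0.
    by have [u hu] := ex i it; exists u.
  by move=> h; have [f hf] := choice h; exists f => i; exact: hf.
have val i j : i \in tight v -> j \in tight v -> dot (a i) (f j) = - (i == j)%:R.
  move=> it jt; have [/directionsP[_ h] e] := hf j jt.
  have [->//|ij] := eqVneq i j.
  by rewrite h ?oppr0 // 2!inE ij; move: it; rewrite inE.
exists (\sum_(j in tight v :\: S) f j) => [|i it iS].
  apply/directionsP; split.
    apply: rpred_sum => j; rewrite finset.in_setD => /andP[_ jt].
    by have [/directionsP[]] := hf j jt.
  move=> i iS; rewrite dot_sumr big1 // => j; rewrite finset.in_setD => /andP[jS jt].
  rewrite val //; last exact: (fintype.subsetP St).
  by case: eqP => [ij|]; rewrite ?oppr0 //; rewrite -ij iS in jS.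
rewrite dot_sumr (bigD1 i) /=; last by rewrite finset.in_setD it iS.
rewrite val // eqxx big1 ?addr0 ?oppr_lt0 ?ltr01 //.
move=> j /andP[]; rewrite finset.in_setD => /andP[jS jt] ji.
by rewrite val // eq_sym (negbTE ji) oppr0.
Qed.

(** From a vertex of the cell, move slightly in a direction that releases
    exactly the tight constraints outside [S]. *)
Lemma cell_interior S : cell S !=set0 -> exists2 z, cell S z & tight z = S.
Proof.
move=> ne; have [v fv St] := cell_vertex ne.
have hv : P v by have [_ [c [d [_ vE]]]] := fv;
  have [] : (P `&` [set x | dot c x = d]) v by rewrite -vE.
have [u uD hu] := release fv St; have [uU hS] := directionsP _ _ uD.
have slack i : i \in ~: tight v -> dot (a i) v < b i.
  by rewrite !inE lt_neqAle member_le // andbT.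
have [e e0 he] := strict_move u slack.
have eS i : i \in S -> dot (a i) (v + e *: u) = b i.
  move=> iS; rewrite dotDr dotZr hS // mulr0 addr0.
  by have := fintype.subsetP St i iS; rewrite inE => /eqP.
have ltS i : i \notin S -> dot (a i) (v + e *: u) < b i.
  move=> iS; have [it|it] := boolP (i \in tight v); last first.
    by apply: he; rewrite ?lexx ?ltW // inE.
  rewrite dotDr dotZr; move: (it); rewrite inE => /eqP ->.
  by rewrite gtrDl pmulr_rlt0 // hu.
exists (v + e *: u); last first.
  apply/setP => i; rewrite inE; have [/eS ->|/ltS lt] := boolP (i \in S).
    by rewrite eqxx.
  by rewrite lt_eqF.
split => //; apply: member_move => // i; have [/eS ->//|/ltS] := boolP (i \in S).
exact: ltW.
Qed.

Lemma common_facets_cell S : cell S !=set0 -> common_facets (cell S) = S.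
Proof.
move=> ne; have [z cz zS] := cell_interior ne; apply/setP => i; rewrite inE.
apply/asboolP/idP => [/(_ z cz) /= e|iS x [_]]; last exact.
by rewrite -zS inE e.
Qed.

Lemma has_dim_cell S : cell S !=set0 -> (#|S| <= n)%N /\ has_dim (cell S) (n - #|S|).
Proof.
move=> ne; have [v fv St] := cell_vertex ne; split.
  by rewrite -(simpleP fv) subset_leq_card.
have [z cz zS] := cell_interior ne.
rewrite -(dim_directions fv St); apply: (has_dim_absorb cz) => [x [hx h]|u uD] /=.
  apply/directionsP; split; first by apply: member_diff => //; case: cz.
  by move=> i iS; rewrite dotBr h //; case: cz => _ ->; rewrite ?subrr.
have [e e0 he] : exists2 e : R, 0 < e & forall t, `|t| <= e -> P (z + t *: u).
  by apply: member_nbhs; [case: cz | rewrite zS].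
exists e => //; split; first by apply: he; rewrite gtr0_norm.
move=> i iS /=; rewrite dotDr dotZr; have [_ ->//] := directionsP _ _ uD.
by rewrite mulr0 addr0; case: cz => _ ->.
Qed.

(** On the sets with a nonempty cell, [cell] is injective with inverse
    [common_facets]; it reaches every face and turns cardinality into codimension. *)
Theorem fnum_cell k : (k <= n)%N ->
  fnum P k = #|[set S : {set I} | (#|S| == n - k)%N & `[< cell S !=set0 >]]%SET|.
Proof.
move=> kn; set A := [set S | _ & _]%SET.
have inA S : S \in A -> #|S| = (n - k)%N /\ cell S !=set0.
  by rewrite inE => /andP[/eqP ? /asboolP].
rewrite /fnum (_ : [set F | _] = [set` [fset cell S | S in A]%fset]).
  rewrite set_fsetK card_in_imfset /= => [|S T /inA[_ hS] /inA[_ hT] e]; last first.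
    by rewrite -(common_facets_cell hS) e common_facets_cell.
  rewrite cardE; apply/perm_size/uniq_perm; rewrite ?enum_finmem_uniq ?enum_uniq //.
apply/seteqP; split => [F [fF dF]|F /imfsetP[S /= SA ->]] /=.
  have FE := face_cell fF; have neF : F !=set0 by case: fF.
  have ne : cell (common_facets F) !=set0 by rewrite -FE.
  apply/imfsetP; exists (common_facets F) => //=; rewrite inE.
  apply/andP; split; last exact/asboolP.
  have [le dim] := has_dim_cell ne; rewrite -FE in dim.
  by rewrite (has_dim_uniq dF dim) subKn.
have [cS ne] := inA _ SA; split; first exact: cell_face.
by have [_] := has_dim_cell ne; rewrite cS subKn.
Qed.

End Vertex.
End FacetSystem.

Section Irredundant.
Variables (R : realType) (m n : nat) (P : set 'rV[R]_m) (I : finType).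
Variables (x0 : 'rV[R]_m) (U : {vspace 'rV[R]_m}).
Variables (a : I -> 'rV[R]_m) (b : I -> R).
Hypothesis dimU : \dim U = n.
Hypothesis dimP : has_dim P n.
Hypothesis P0 : P x0.
Hypothesis minU : forall V : {vspace 'rV[R]_m}, P `<=` [set x | x - x0 \in V] -> (U <= V)%VS.
Hypothesis PE : P = [set x | x - x0 \in U /\ forall i, dot (a i) x <= b i].
Hypothesis irr : forall i,
  P <> [set x | x - x0 \in U /\ forall j, j != i -> dot (a j) x <= b j].

Local Notation cell := (cell P a b).

Lemma redundant_outside i :
  exists2 x, x - x0 \in U /\ (forall j, j != i -> dot (a j) x <= b j) &
    b i < dot (a i) x.
Proof.
apply: contrapT => nex; apply: (irr (i := i)); apply/seteqP; split => x.
  by rewrite PE => -[xU h]; split => // j _.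
move=> [xU h]; rewrite PE; split => // j.
have [->|/h//] := eqVneq j i; rewrite leNgt; apply/negP => lt.
by apply: nex; exists x.
Qed.

Lemma slack_somewhere i : exists2 x, P x & dot (a i) x < b i.
Proof.
apply: contrapT => nex.
have tightP x : P x -> dot (a i) x = b i.
  move=> hx; apply/eqP; rewrite eq_le (member_le PE) //= leNgt; apply/negP => lt.
  by apply: nex; exists x.
have Uh : (U <= hyper (a i))%VS.
  by apply: minU => x hx /=; rewrite mem_hyper dotBr !tightP ?subrr.
have [x [xU _]] := redundant_outside i; have := subvP Uh _ xU.
by rewrite mem_hyper dotBr (tightP _ P0) subr_eq0 => /eqP ->; rewrite ltxx.
Qed.

Lemma interior_point : exists2 y, P y & forall i, dot (a i) y < b i.
Proof.
have [|x y|i x _|i _|y hy h] := @common_slack _ _ _ a b P finset.setT.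
- by exists x0.
- exact: (member_mid PE).
- exact: (member_le PE).
- exact: slack_somewhere.
by exists y => // i; apply: h; rewrite inE.
Qed.

(** Where the segment from an interior point to a point violating constraint [i]
    alone leaves [P], only constraint [i] is tight. *)
Lemma wall_point i : exists2 w, P w & tight a b w = [set i]%SET.
Proof.
have [y hy yb] := interior_point; have [x [xU xb] xi] := redundant_outside i.
pose D := dot (a i) x - dot (a i) y; pose t := (b i - dot (a i) y) / D.
have yi := yb i; have D0 : 0 < D by rewrite /D; lra.
have t01 : 0 < t < 1.
  apply/andP; split; first by rewrite divr_gt0 // subr_gt0.
  by rewrite ltr_pdivrMr // mul1r /D; lra.
pose w := y + t *: (x - y).
have wE j : dot (a j) w = (1 - t) * dot (a j) y + t * dot (a j) x.
  by rewrite dotDr dotZr dotBr; lra.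
have wi : dot (a i) w = b i.
  have : t * D = b i - dot (a i) y by rewrite divfK ?gt_eqF.
  by rewrite wE /D; lra.
have wj j : j != i -> dot (a j) w < b j.
  by move=> ji; rewrite wE; have := xb j ji; have := yb j; nra.
exists w.
  rewrite PE; split => [|j]; last first.
    by have [->|/wj/ltW//] := eqVneq j i; rewrite wi.
  rewrite (_ : w - x0 = (1 - t) *: (y - x0) + t *: (x - x0)).
    by rewrite rpredD ?rpredZ // (member_affine PE).
  by apply/rowP => j; rewrite !mxE; lra.
apply/setP => j; rewrite !inE; have [->|/wj lt] := eqVneq j i; first by rewrite wi eqxx.
by rewrite lt_eqF.
Qed.

Lemma has_dim_wall i : exists2 k, n = k.+1 & has_dim (cell [set i]%SET) k.
Proof.
have [w hw wt] := wall_point i; have [y hy yb] := interior_point.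
have cw : cell [set i]%SET w.
  by split => // j; rewrite -wt inE => /eqP.
have lt : (\dim (directions U a [set i]%SET) < n)%N.
  have -> : directions U a [set i]%SET = (U :&: hyper (a i))%VS.
    by rewrite /directions big_set1.
  rewrite -dimU; apply: (@dim_cap_hyper_lt _ _ _ _ (y - w)).
    exact: (member_diff PE).
  have wi : dot (a i) w = b i by apply: cw.2; rewrite inE.
  by rewrite dotBr wi lt_eqF // subr_lt0.
have ge : (n <= (\dim (directions U a [set i]%SET)).+1)%N.
  have := dim_directionsU1 U a finset.set0 i; rewrite finset.setU0; apply: leq_trans.
  rewrite -{1}dimU; apply: dimvS; apply/subvP => u uU; apply/directionsP.
  by split => // j; rewrite inE.
exists (\dim (directions U a [set i]%SET)).
  by apply/eqP; rewrite eqn_leq ge lt.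
apply: (has_dim_absorb cw) => [x [hx h]|u uD] /=.
  apply/directionsP; split; first exact: (member_diff PE).
  by move=> j js; rewrite dotBr h // cw.2 // subrr.
have [|e e0 he] := member_nbhs PE hw (u := u); first by rewrite wt.
exists e => //; split; first by apply: he; rewrite gtr0_norm.
move=> j js /=; rewrite dotDr dotZr; have [_ ->//] := directionsP _ _ _ _ uD.
by rewrite mulr0 addr0 cw.2.
Qed.

Lemma wall_facet i : facet P (cell [set i]%SET).
Proof.
have [k nk dk] := has_dim_wall i; split; last by exists k; rewrite -nk.
have [z [_ [cz _ _ _]]] := dk.
by apply: (cell_face PE); exists z.
Qed.

(** A facet lies in some wall; the two have the same dimension, hence the same
    affine span, on which the form exposing the facet is constant. *)
Lemma facet_wall F : facet P F -> exists i, F = cell [set i]%SET.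
Proof.
move=> [fF [k [dPk dFk]]]; have FE := face_cell PE fF.
have nk := has_dim_uniq dimP dPk.
have [i iF] : exists i, i \in common_facets a b F.
  apply/set0Pn; apply/eqP => e; have FP : F = P.
    by rewrite FE e; apply/seteqP; split => [x []//|x hx]; split => // j; rewrite inE.
  have := has_dim_uniq dPk; rewrite -FP => /(_ _ dFk)/eqP.
  by rewrite eqn_leq ltnn.
have Fi : F `<=` cell [set i]%SET.
  rewrite FE => x [hx h]; split => // j; rewrite inE => /eqP ->; exact: h.
exists i; apply/seteqP; split => //.
have [k' nk' di] := has_dim_wall i.
have ek : k' = k by move: nk'; rewrite nk => -[].
have [[z Fz] [c [d [cle Fcd]]]] := fF.
have [W [dW FW minW]] := has_dim_at dFk Fz.
have [W' [dW' iW' minW']] := has_dim_at di (Fi _ Fz).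
have eW : W = W'.
  apply/eqP; rewrite eqEdim dW' ek dW leqnn andbT; apply: minW => x /Fi; exact: iW'.
have Wc : (W <= hyper c)%VS.
  apply: minW => x; rewrite /= mem_hyper dotBr; move: Fz; rewrite {1 2}Fcd.
  by move=> [_ /= ->] [_ /= ->]; rewrite subrr.
move=> x cx; rewrite Fcd; split; first by case: cx.
have := subvP Wc (x - z); rewrite eW => /(_ (iW' _ cx)).
by rewrite mem_hyper dotBr subr_eq0 /= => /eqP ->; move: Fz; rewrite {1}Fcd => -[].
Qed.

Lemma wall_inj i j : cell [set i]%SET = cell [set j]%SET -> i = j.
Proof.
have [w hw wt] := wall_point i => e.
have : cell [set j]%SET w by rewrite -e; split => // l; rewrite -wt inE => /eqP.
move=> [_ /(_ j)]; rewrite inE eqxx => /(_ isT) wj.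
have : j \in tight a b w by rewrite inE wj.
by rewrite wt inE => /eqP.
Qed.

End Irredundant.

(** In a minimal subsystem of the inequalities defining [P], the walls are
    pairwise distinct and are exactly the facets, so that the facets can index it. *)
Theorem facet_representation (R : realType) (m n : nat) (P : set 'rV[R]_m)
    (L : finType) (phi : L -> set 'rV[R]_m) :
    polytope P -> has_dim P n -> range phi = facet P ->
  exists x0 U (a : L -> 'rV[R]_m) b,
    [/\ \dim U = n, P = [set x | x - x0 \in U /\ forall l, dot (a l) x <= b l] &
      forall l, phi l = P `&` [set x | dot (a l) x = b l]].
Proof.
move=> [_ [k [a [b PE]]]] dP rphi; have [x0 [U [P0 dU PU minU]]] := dP.
pose defines (J : {set 'I_k}) := `[< P =
  [set x | x - x0 \in U /\ forall i, i \in J -> dot (a i) x <= b i] >].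
have [|J /minsetP[/asboolP PJ minJ] _] := @minset_exists _ defines finset.setT.
  apply/asboolP; rewrite {1}PE; apply/seteqP; split => x h; last first.
    by move=> i; case: h => _; apply; rewrite inE.
  by split=> // ; apply: PU; rewrite PE.
pose I := {i : 'I_k | i \in J}.
pose aI (i : I) := a (val i); pose bI (i : I) := b (val i).
have PI : P = [set x | x - x0 \in U /\ forall i, dot (aI i) x <= bI i].
  rewrite PJ; apply/seteqP; split => x [xU h]; split => // i; first exact: h (valP i).
  by move=> iJ; apply: (h (exist _ i iJ)).
have irr (i : I) :
    P <> [set x | x - x0 \in U /\ forall j, j != i -> dot (aI j) x <= bI j].
  move=> e; have : defines (J :\ val i).
    apply/asboolP; rewrite e; apply/seteqP; split => x [xU h]; split => // j.
      rewrite !inE => /andP[ji jJ]; apply: (h (exist _ j jJ)).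
      by rewrite -val_eqE.
    by move=> ji; apply: h; rewrite !inE ji (valP j).
  move=> /minJ/(_ (subD1set _ _))/setP/(_ (val i)).
  by rewrite !inE eqxx (valP i).
have wallP := facet_wall dU dP P0 minU PI irr.
have Pwall := wall_facet dU dP P0 minU PI irr.
have wphi l : exists i : I, phi l = cell P aI bI [set i]%SET.
  by apply: wallP; rewrite -rphi; exists l.
have [f hf] := choice wphi.
have fsur i : exists l, f l = i.
  have : facet P (cell P aI bI [set i]%SET) by exact: Pwall.
  rewrite -rphi => -[l _ e]; exists l; apply: (wall_inj P0 minU PI irr).
  by rewrite -e hf.
exists x0, U, (aI \o f), (bI \o f); split => //.
  rewrite {1}PI; apply/seteqP; split => x [xU h]; split => // i; first exact: h.
  by have [l <-] := fsur i; exact: h.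
move=> l; rewrite hf; apply/seteqP; split => x [hx h]; split => //=.
  by apply: h; rewrite inE.
by move=> i; rewrite inE => /eqP ->.
Qed.

Lemma bounded_no_ray (R : realType) (m : nat) (P : set 'rV[R]_m) (x u : 'rV[R]_m) :
  bounded_set P -> (forall t : R, 0 <= t -> P (x + t *: u)) -> u = 0.
Proof.
move=> [M [Mr hM]] ray; apply/eqP; rewrite -normr_eq0; apply: contrapT => /negP un0.
have u0 : 0 < `|u| by rewrite lt_neqAle eq_sym un0 normr_ge0.
have B y : P y -> `|y| <= `|M| + 1.
  by apply: hM; rewrite (le_lt_trans (ler_norm M)) // ltrDl.
pose t := (`|M| + 2 + `|x|) / `|u|.
have t0 : 0 <= t by rewrite divr_ge0 ?addr_ge0.
have := B _ (ray t t0); rewrite leNgt => /negP; apply.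
have : `|t *: u| <= `|x + t *: u| + `|x|.
  by rewrite -[X in `|X| <= _](addKr x) addrC addrC (le_trans (ler_normD _ _)) // normrN addrC.
rewrite normrZ (ger0_norm t0) /t divfK ?gt_eqF //; lra.
Qed.

(** The counting of cells, with the facets as indices of the inequalities. *)
Theorem fnum_simple (R : realType) (m n : nat) (P : set 'rV[R]_m)
    (L : finType) (phi : L -> set 'rV[R]_m) (k : nat) :
    simple_polytope n P -> injective phi -> range phi = facet P -> (k <= n)%N ->
  fnum P k = #|[set S : {set L} | (#|S| == n - k)%N &
    `[< (P `&` \bigcap_(l in [set` S]) phi l) !=set0 >]]%SET|.
Proof.
move=> [polyP dP simpleP] iphi rphi kn.
have [x0 [U [a [b [dU PE phiE]]]]] := facet_representation polyP dP rphi.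
rewrite (fnum_cell dU PE _ _ kn); last 2 first.
- by move=> x u _; apply: bounded_no_ray; case: polyP.
- move=> v fv; have hv : P v by have [_ [c [d [_ vE]]]] := fv;
    have [] : (P `&` [set x | dot c x = d]) v by rewrite -vE.
  have tE : [set F | facet P F /\ F v] = [set` [fset phi l | l in tight a b v]%fset].
    rewrite -rphi; apply/seteqP; split => [F [[l _ <-]]|F /imfsetP[l /= lt ->]] /=.
      rewrite phiE => -[_ /= lv]; apply/imfsetP; exists l => //=.
      by rewrite inE lv.
    split; first by exists l.
    by rewrite phiE; split => //=; move: lt; rewrite inE => /eqP.
  have := simpleP v fv; rewrite tE => /card_eq_fsetP <-.
  rewrite card_in_imfset /= => [|l l' _ _ /iphi //].
  by rewrite cardE; apply/perm_size/uniq_perm; rewrite ?enum_finmem_uniq ?enum_uniq.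
congr #|pred_of_set _|; apply/setP => S; rewrite !inE; congr (_ && _).
apply: asbool_equiv_eq; split => -[x [hx h]]; exists x; split => //.
  by move=> l /= lS; rewrite phiE; split => //; exact: h.
by move=> l lS; have := h l lS; rewrite phiE => -[].
Qed.

End Polytopes.

(** * Diagonals of a regular polygon *)

Section Orientation.
Variable R : realType.
Implicit Types p q r : R * R.

(** Twice the signed area of the triangle [p q r]. *)
Definition orient p q r : R :=
  (q.1 - p.1) * (r.2 - p.2) - (q.2 - p.2) * (r.1 - p.1).

Definition open_segment p q : set (R * R) :=
  [set x | exists2 t : R, 0 < t < 1 & x = (1 - t) *: p + t *: q].

Lemma orientC23 p q r : orient p r q = - orient p q r.
Proof. by rewrite /orient; ring. Qed.

Lemma segment_pointE p q (t : R) : (1 - t) *: p + t *: q =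
  ((1 - t) * p.1 + t * q.1, (1 - t) * p.2 + t * q.2).
Proof. by []. Qed.

Lemma orient_segment p q x y (t : R) :
  orient p q ((1 - t) *: x + t *: y) = (1 - t) * orient p q x + t * orient p q y.
Proof. by rewrite segment_pointE /orient /=; ring. Qed.

Lemma segments_disjoint p q x y :
    orient p q x <= 0 -> orient p q y <= 0 ->
    orient p q x < 0 \/ orient p q y < 0 ->
  (open_segment p q `&` open_segment x y = classical_sets.set0)%classic.
Proof.
move=> hx hy hxy; apply/seteqP; split => // z [[t t01 ->] [s s01]].
move/(congr1 (orient p q)); rewrite !orient_segment.
have -> : orient p q p = 0 by rewrite /orient; ring.
have -> : orient p q q = 0 by rewrite /orient; ring.
by case: hxy => ?; nra.
Qed.

(** The affine dependency [qrs] p + [pqs] r = [prs] q + [pqr] s of four points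
    of the plane. *)
Lemma segments_meet p q r s :
    0 < orient p q r -> 0 < orient p q s -> 0 < orient p r s -> 0 < orient q r s ->
  (open_segment p r `&` open_segment q s !=set0)%classic.
Proof.
move=> h1 h2 h3 h4; pose S := orient q r s + orient p q s.
have ES : S = orient p r s + orient p q r by rewrite /S /orient; ring.
have S0 : 0 < S by rewrite addr_gt0.
have Sn : S != 0 by rewrite gt_eqF.
exists ((1 - orient p q s / S) *: p + (orient p q s / S) *: r); split.
  exists (orient p q s / S) => //; apply/andP; split; first exact: divr_gt0.
  by rewrite ltr_pdivrMr // mul1r /S ltrDr.
exists (orient p q r / S).
  apply/andP; split; first exact: divr_gt0.
  by rewrite ltr_pdivrMr // mul1r ES ltrDr.
have comb (A B C D : R) : A + B = S -> C + D = S ->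
  forall (x y z w : R), A * x + B * y = C * z + D * w ->
  (1 - B / S) * x + B / S * y = (1 - D / S) * z + D / S * w.
  move=> AB CD x y z w e.
  have -> : 1 - B / S = A / S by rewrite (_ : A = S - B) ?mulrBl ?divff // -AB addrK.
  have -> : 1 - D / S = C / S by rewrite (_ : C = S - D) ?mulrBl ?divff // -CD addrK.
  by rewrite -!mulrA ![S^-1 * _]mulrC !mulrA -!mulrDl e.
rewrite !segment_pointE.
by congr pair; (apply: comb; [done | by rewrite ES | rewrite /orient; ring]).
Qed.

(** Points of the circle are parametrized by half their angle: the orientation of
    a triangle then factors into sines of differences, whose signs are known. *)
Lemma orient_circle (x u v : R) :
  let P y := (cos (2 * y), sin (2 * y)) in
  orient (P x) (P (x + u)) (P (x + u + v)) = 4 * sin u * sin v * sin (u + v).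
Proof.
have c1 := cos2Dsin2 x; have c2 := cos2Dsin2 u; have c3 := cos2Dsin2 v.
have cE (y : R) : cos (2 * y) = cos y ^+ 2 - sin y ^+ 2.
  by rewrite mulr_natl mulr2n cosD -!expr2.
have sE (y : R) : sin (2 * y) = 2 * (sin y * cos y).
  by rewrite mulr_natl mulr2n sinD [cos y * _]mulrC -mulr2n mulr_natl.
move=> P; rewrite /P /orient /= !mulrDr !(sinD, cosD) !(cE, sE).
set a := cos x in c1 *; set b := sin x in c1 *; set c := cos u in c2 *.
set d := sin u in c2 *; set e := cos v in c3 *; set f := sin v in c3 *.
have -> : 4 * d * f * (d * e + c * f) =
  4 * d * f * (d * e + c * f) * (a ^+ 2 + b ^+ 2) ^+ 2 by rewrite c1; ring.
have eb : b ^+ 2 = 1 - a ^+ 2 by rewrite -c1; ring.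
have ed : d ^+ 2 = 1 - c ^+ 2 by rewrite -c2; ring.
have ef : f ^+ 2 = 1 - e ^+ 2 by rewrite -c3; ring.
ring: eb ed ef.
Qed.

End Orientation.

Section RegularPolygon.
Variables (n : nat) (hn : (2 <= n)%N).

Lemma vertices_gt0 : (0 < n.*2)%N. Proof. by rewrite double_gt0 ltnW. Qed.

(** Vertices are addressed by all natural numbers, modulo [2n], so that any
    cyclic configuration unrolls into an increasing sequence. *)
Definition vtx (z : nat) : 'I_(n.*2) := Ordinal (ltn_pmod z vertices_gt0).

Definition polygon_diag (a b : nat) : {set 'I_(n.*2)} := [set vtx a; vtx b].

Lemma vtx_eq a b : (vtx a == vtx b) = (a == b %[mod n.*2]).
Proof. by []. Qed.

Lemma vtxD a : vtx (a + n.*2) = vtx a.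
Proof. by apply/val_inj; rewrite /= modnDr. Qed.

Lemma vtx_val (v : 'I_(n.*2)) : vtx v = v.
Proof. by apply/val_inj; rewrite /= modn_small. Qed.

Lemma vtx_neq a b : (a < b < a + n.*2)%N -> vtx a != vtx b.
Proof.
move=> /andP[ab ba]; rewrite vtx_eq eq_sym eqn_mod_dvd; last exact: ltnW.
by rewrite gtnNdvd ?subn_gt0 // ltn_subLR // ltnW.
Qed.

Variable R : realType.

Definition vertex_point (z : nat) : R * R := polygon_vertex R (vtx z).

Definition half_angle (z : nat) : R := z%:R * (pi / n.*2%:R).

Lemma vertex_pointE z : vertex_point z = (cos (2 * half_angle z), sin (2 * half_angle z)).
Proof.
have n0 : n.*2%:R != 0 :> R by rewrite pnatr_eq0 -lt0n vertices_gt0.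
have e : 2 * half_angle z =
    2 * pi * (z %% n.*2)%:R / n.*2%:R + (pi *+ 2) *+ (z %/ n.*2).
  rewrite /half_angle {1}(divn_eq z n.*2) natrD natrM -[_ *+ _]mulr_natr.
  by rewrite -[pi *+ 2]mulr_natl; field.
by rewrite /vertex_point /polygon_vertex e (periodicn (@cosD2pi R)) (periodicn (@sinD2pi R)).
Qed.

Lemma sin_half_angle a b : (a < b < a + n.*2)%N ->
  0 < sin (half_angle b - half_angle a).
Proof.
move=> /andP[ab ba]; have n0 : 0 < n.*2%:R :> R by rewrite ltr0n vertices_gt0.
rewrite -mulrBl -natrB ?(ltnW ab) // sin_gt0_pi // mulr_gt0 ?divr_gt0 ?pi_gt0 //=.
  rewrite mulrA ltr_pdivrMr // mulrC ltr_pM2l ?pi_gt0 // ltr_nat.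
  by rewrite ltn_subLR // ltnW.
by rewrite ltr0n subn_gt0.
Qed.

Lemma orient_vertex_point a b c : (a < b)%N -> (b < c)%N -> (c < a + n.*2)%N ->
  0 < orient (vertex_point a) (vertex_point b) (vertex_point c).
Proof.
move=> ab bc ca; rewrite !vertex_pointE.
have := orient_circle (half_angle a) (half_angle b - half_angle a)
  (half_angle c - half_angle b).
have -> : half_angle a + (half_angle b - half_angle a) = half_angle b by ring.
have -> : half_angle b + (half_angle c - half_angle b) = half_angle c by ring.
have -> : half_angle b - half_angle a + (half_angle c - half_angle b) =
  half_angle c - half_angle a by ring.
by move=> /= ->; rewrite !mulr_gt0 ?sin_half_angle //; lia.
Qed.

Lemma diagonal_interiorE a b : vtx a != vtx b ->
  @diagonal_interior n R (polygon_diag a b) = open_segment (vertex_point a) (vertex_point b).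
Proof.
move=> ab; apply/seteqP; split => p /=; last first.
  by move=> [t t01 ->]; exists (vtx a), (vtx b), t.
move=> [u [v [t [e uv t01 ->]]]].
have: u \in polygon_diag a b by rewrite e set21.
have: v \in polygon_diag a b by rewrite e set22.
rewrite !inE => /orP[]/eqP hv /orP[]/eqP hu; rewrite hu hv ?eqxx // in uv *.
  exists (1 - t); first by move: t01 => /andP[? ?]; apply/andP; split; lra.
  by rewrite subKr addrC.
by exists t.
Qed.

Lemma orient_outside a b c : (a < b < a + n.*2)%N -> (a <= c <= b)%N ->
  orient (vertex_point a) (vertex_point b) (vertex_point c) <= 0 ?= iff ((c == a) || (c == b)).
Proof.
move=> ab ac; have [->|ca] := eqVneq c a.
  have -> : orient (vertex_point a) (vertex_point b) (vertex_point a) = 0 by rewrite /orient; ring.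
  by split; rewrite ?lexx ?eqxx.
have [->|cb] := eqVneq c b.
  have -> : orient (vertex_point a) (vertex_point b) (vertex_point b) = 0 by rewrite /orient; ring.
  by split; rewrite ?lexx ?eqxx.
have lt : orient (vertex_point a) (vertex_point b) (vertex_point c) < 0.
  by rewrite orientC23 oppr_lt0 orient_vertex_point //; lia.
by split; [exact: ltW | rewrite lt_eqF].
Qed.

(** The endpoints of the second diagonal are weakly on one side of the first, and
    not both on it. *)
Lemma diagonals_disjoint a b c d : (a < b < a + n.*2)%N ->
    (a <= c)%N -> (c < d)%N -> (d <= b)%N -> (a, b) != (c, d) ->
  (@diagonal_interior n R (polygon_diag a b) `&`
    @diagonal_interior n R (polygon_diag c d) = classical_sets.set0)%classic.
Proof.
move=> ab ac cd db ne; rewrite !diagonal_interiorE ?vtx_neq //; last by lia.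
have hc := @orient_outside a b c ab; have hd := @orient_outside a b d ab.
have {}hc := hc ltac:(lia); have {}hd := hd ltac:(lia).
apply: segments_disjoint; [exact: hc.1 | exact: hd.1|].
rewrite !lt_neqAle hc.1 hd.1 !andbT hc.2 hd.2; apply/orP.
by move: ne; rewrite xpair_eqE; lia.
Qed.

Lemma diagonals_meet a b c d : (a < c)%N -> (c < b)%N -> (b < d)%N -> (d < a + n.*2)%N ->
  (@diagonal_interior n R (polygon_diag a b) `&`
    @diagonal_interior n R (polygon_diag c d) !=set0)%classic.
Proof.
move=> ac cb bd da; rewrite !diagonal_interiorE ?vtx_neq //; try lia.
by apply: segments_meet; apply: orient_vertex_point; lia.
Qed.

End RegularPolygon.

(** * Dissections along a path *)

Definition crossing (a b c d : nat) :=
  [|| (a < c) && (c < b) && (b < d) | (c < a) && (a < d) && (d < b)]%N.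

Section Transfer.
Variables (K : comNzRingType) (x : K).
Implicit Types h : nat -> K.

Fixpoint fan_sum h (v : nat) : K :=
  if v is v'.+1 then (1 + x) * fan_sum h v' + x * h v'.+1 else 0.

(** Let [h] weigh the number of visible vertices. Adding a vertex to a path with [v]
    visible vertices other than its end either joins the new vertex to nothing,
    leaving [v.+1] of them, or joins it to a nonempty set of visible vertices, whose
    least element is the last one that stays visible: the second possibility
    contributes [fan_sum], with a factor [x] per arc. *)
Definition transfer h (v : nat) : K := h v.+1 + fan_sum h v.

(** Let [u] be the largest element of [V]. The sets avoiding [u] give the sum for
    [V :\ u]; the set [[set u]] gives [x * h #|V|]; adding [u] to a nonempty set
    avoiding it keeps the minimum and multiplies the term by [x]. *)
Lemma fan_sum_subsets N h (V : {set 'I_N}) :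
  \sum_(S : {set 'I_N} | (S \subset V) && (S != set0))
    x ^+ #|S| * h #|[set e in V | [forall s in S, (e <= s)%N]]| = fan_sum h #|V|.
Proof.
move: {2}#|V| (erefl #|V|) => k; elim: k V => [|k IH] V cV.
  have -> : V = set0 by apply/eqP; rewrite -cards_eq0 cV.
  rewrite cards0 big1 // => S; rewrite subset0 => /andP[/eqP->].
  by rewrite eqxx.
have [i iV] : exists i, i \in V by apply/set0Pn; rewrite -cards_eq0 cV.
pose u := [arg max_(e > i in V) (e : nat)]%N.
have [uV umax] : u \in V /\ forall e, e \in V -> (e <= u)%N.
  by rewrite /u; case: arg_maxnP.
pose W := V :\ u; have cW : #|W| = k by move: cV; rewrite (cardsD1 u) uV => -[].
have uW : u \notin W by rewrite !inE eqxx.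
have rankW (S : {set 'I_N}) : S \subset W -> S != set0 ->
    [set e in V | [forall s in S, (e <= s)%N]] = [set e in W | [forall s in S, (e <= s)%N]].
  move=> SW /set0Pn[s sS]; apply/setP => e; rewrite !inE.
  have [->|//] := eqVneq e u; rewrite uV /=; apply/negbTE/forall_inPn.
  exists s => //; have := subsetP SW s sS; rewrite !inE => /andP[su sV].
  by rewrite -ltnNge ltn_neqAle (umax _ sV) andbT.
rewrite cV /= (bigID (fun S : {set 'I_N} => u \in S)) /= addrC.
have VE : V = u |: W by rewrite setD1K.
have noU (S : {set 'I_N}) : (S \subset V) && (S != set0) && (u \notin S) =
    (S \subset W) && (S != set0).
  by rewrite /W subsetD1 andbAC.
under eq_bigl do rewrite noU.
rewrite (eq_bigr (fun S : {set 'I_N} => x ^+ #|S| *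
   h #|[set e in W | [forall s in S, (e <= s)%N]]|)); last first.
  by move=> S /andP[SW S0]; rewrite rankW.
rewrite IH // cW mulrDl mul1r -addrA; congr (_ + _).
rewrite (reindex_onto (fun S => u |: S) (fun S => S :\ u)) /=; last first.
  by move=> S /andP[_ uS]; rewrite setD1K.
rewrite (eq_bigl (fun S : {set 'I_N} => S \subset W)); last first.
  move=> S; rewrite setU11 andbT VE; apply/andP/idP.
    move=> [/andP[SW _] /eqP e]; rewrite -e; apply/subsetP => y.
    rewrite inE => /andP[yu /(subsetP SW)]; rewrite in_setU1.
    by move: yu; rewrite inE => /negbTE ->.
  move=> SW; have uS : u \notin S by apply: contra uW; apply: subsetP.
  rewrite setUS //= setU1K // eqxx; split => //.
  by apply/set0Pn; exists u; rewrite setU11.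
rewrite (bigD1 set0) ?sub0set //= setU0 cards1 expr1 addrC.
have -> : [set e in V | [forall s in [set u], (e <= s)%N]] = V.
  apply/setP => e; rewrite inE; have [eV|//] := boolP (e \in V).
  by apply/forall_inP => s; rewrite inE => /eqP ->; apply: umax.
rewrite cV; congr (_ + _); rewrite -cW -IH // big_distrr /=; apply: eq_bigr => S.
move=> /andP[SW S0]; have uS : u \notin S by apply: contra uW; apply: subsetP.
rewrite cardsU1 uS add1n exprS -mulrA; congr (_ * (_ * h _)); rewrite -rankW //.
apply: eq_card => e; rewrite !inE; have [eV|//] := boolP (e \in V); rewrite /=.
apply/forall_inP/forall_inP => le s sS; first by apply: le; rewrite inE sS orbT.
by move: sS; rewrite !inE => /orP[/eqP ->|]; [apply: umax | apply: le].
Qed.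

End Transfer.

Section PathDissections.
Variables (K : comNzRingType) (x : K) (N : nat).
Local Notation arc := ('I_N.+1 * 'I_N.+1)%type.
Implicit Types (T : {set arc}) (S : {set 'I_N.+1}) (h : nat -> K).

(** The arcs are the diagonals and the long side of a polygon with vertices
    [0, ..., m], drawn above a line. *)
Definition dissection (m : nat) T : bool :=
  [forall p in T, (p.1 + 2 <= p.2 <= m)%N] &&
  [forall p in T, forall q in T, ~~ crossing p.1 p.2 q.1 q.2].

Definition visible T (e : nat) : bool := [forall p in T, ~~ ((p.1 < e) && (e < p.2))%N].

(** The vertex [m], visible in every dissection of [0, ..., m], is left out. *)
Definition visibles (m : nat) T : {set 'I_N.+1} := [set e : 'I_N.+1 | (e < m)%N && visible T e].

Lemma dissectionP m T : reflect
  ((forall p, p \in T -> (p.1 + 2 <= p.2 <= m)%N) /\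
   (forall p q, p \in T -> q \in T -> ~~ crossing p.1 p.2 q.1 q.2))
  (dissection m T).
Proof.
apply: (iffP andP) => -[h1 h2]; split.
- exact/forall_inP.
- by move=> p q pT qT; move/forall_inP: h2 => /(_ p pT)/forall_inP; apply.
- exact/forall_inP.
by apply/forall_inP => p pT; apply/forall_inP => q qT; apply: h2.
Qed.

Lemma visibleP T e : reflect (forall p, p \in T -> ~~ ((p.1 < e) && (e < p.2))%N) (visible T e).
Proof. exact: forall_inP. Qed.

Section Step.
Variables (m : nat) (mN : (m < N)%N).

Definition last_vertex : 'I_N.+1 := Ordinal (mN : (m.+1 < N.+1)%N).

Definition fan S : {set arc} := [set p : arc | (p.1 \in S) && (p.2 == last_vertex)].

Definition glue (p : {set arc} * {set 'I_N.+1}) : {set arc} := p.1 :|: fan p.2.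

Definition unglue T : {set arc} * {set 'I_N.+1} :=
  ([set p in T | (p.2 <= m)%N], [set s | (s, last_vertex) \in T]).

Lemma unglueK T : dissection m.+1 T -> glue (unglue T) = T.
Proof.
move=> /dissectionP[le _]; apply/setP => -[a b]; rewrite !inE /=.
have [abT|abT] /= := boolP ((a, b) \in T).
  have := le _ abT; rewrite /= => /andP[_]; rewrite leq_eqVlt ltnS => /orP[/eqP e|->//].
  have eb : b = last_vertex by apply/val_inj.
  by rewrite -eb abT eqxx orbT.
have [e|_] := eqVneq b last_vertex; last by rewrite andbF.
by rewrite -e (negbTE abT).
Qed.

Lemma glueK T S : dissection m T -> unglue (glue (T, S)) = (T, S).
Proof.
move=> /dissectionP[le _]; congr pair; apply/setP;
  [move=> [a b]|move=> s]; rewrite !inE /=.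
  have [->/=|ne] := eqVneq b last_vertex; last first.
    by rewrite andbF orbF; apply: andb_idr => /le /=; lia.
  rewrite ltnn andbF; apply/esym/negbTE/negP => /le /=; lia.
rewrite eqxx andbT; case: (boolP ((s, last_vertex) \in T)) => // /le /=; lia.
Qed.

(** An arc ending at the new vertex crosses no arc of [T] exactly when it
    starts at a vertex visible for [T]; the bound [s < m] excludes a side. *)
Lemma glue_dissection T S :
  dissection m.+1 (glue (T, S)) && (unglue (glue (T, S)) == (T, S)) =
  dissection m T && (S \subset visibles m T).
Proof.
apply/andP/andP.
  move=> [/dissectionP[le nc] /eqP e].
  have inT p : p \in T -> p \in glue (T, S) by rewrite inE => ->.
  have inS s : s \in S -> (s, last_vertex) \in glue (T, S).
    by move=> sS; rewrite !inE /= sS eqxx orbT.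
  have [eT _] : unglue (glue (T, S)) = (T, S) by [].
  have Tm p : p \in T -> (p.2 <= m)%N by rewrite -{1}[T]/((T, S).1) -e inE => /andP[].
  split.
    apply/dissectionP; split => [p pT|p q pT qT]; last by apply: nc; apply: inT.
    by have := le p (inT p pT) => /andP[-> _]; rewrite Tm.
  apply/subsetP => s sS; rewrite inE; have := le _ (inS s sS); rewrite /= => sm.
  apply/andP; split; first by lia.
  apply/visibleP => p pT; have := nc _ _ (inT p pT) (inS s sS).
  by have := Tm p pT; rewrite /crossing /=; lia.
move=> [dT /subsetP SV]; rewrite glueK // eqxx; split => //.
have [le nc] := dissectionP _ _ dT.
have vis s p : s \in S -> p \in T -> (s < m)%N /\ ~~ ((p.1 < s) && (s < p.2))%N.
  by move=> /SV; rewrite inE => /andP[sm /visibleP] h /h.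
apply/dissectionP; split => [p|p q]; rewrite !inE.
  move=> /orP[/le|/andP[sS /eqP->]] /=; first by lia.
  by have := SV _ sS; rewrite inE => /andP[sm _]; lia.
move=> /orP[pT|/andP[sS /eqP e]] /orP[qT|/andP[s'S /eqP e']].
- exact: nc.
- by have [] := vis _ _ s'S pT; have := le p pT; rewrite e' /crossing /=; lia.
- by have [] := vis _ _ sS qT; have := le q qT; rewrite e /crossing /=; lia.
by rewrite e e' /crossing; lia.
Qed.

Lemma visible_glue T S e : dissection m T -> (e <= m)%N ->
  visible (glue (T, S)) e = visible T e && [forall s in S, (e <= s)%N].
Proof.
move=> /dissectionP[le _] em; apply/visibleP/andP => [h|[/visibleP hT /forall_inP hS] p].
  split; first by apply/visibleP => p pT; apply: h; rewrite inE pT.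
  apply/forall_inP => s sS; have := h (s, last_vertex).
  by rewrite !inE /= sS eqxx orbT => /(_ isT); lia.
rewrite !inE => /orP[/hT//|/andP[/hS es /eqP ->]] /=; lia.
Qed.

Lemma visibles_glue0 T : dissection m T -> #|visibles m.+1 (glue (T, set0))| = #|visibles m T|.+1.
Proof.
move=> dT; have [le _] := dissectionP _ _ dT.
have mN1 : (m < N.+1)%N by rewrite ltnS ltnW.
rewrite (cardsD1 (Ordinal mN1)) inE ltnSn visible_glue //=.
have -> /= : visible T m && [forall s in (set0 : {set 'I_N.+1}), (m <= s)%N].
  apply/andP; split; last by apply/forall_inP => s; rewrite inE.
  by apply/visibleP => p /le; lia.
congr _.+1; apply: eq_card => e; rewrite !inE -val_eqE /= ltnS.
have [em|em] := leqP e m; last by rewrite andbF; apply/esym; rewrite ltnNge ltnW.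
rewrite visible_glue // andTb ltn_neqAle em andbT; congr (_ && _).
by apply/andb_idr => _; apply/forall_inP => s; rewrite inE.
Qed.

(** The fan hides every vertex beyond its least foot. *)
Lemma visibles_glue T S : dissection m T -> S \subset visibles m T -> S != set0 ->
  visibles m.+1 (glue (T, S)) = [set e in visibles m T | [forall s in S, (e <= s)%N]].
Proof.
move=> dT /subsetP SV /set0Pn[s sS]; have := SV s sS; rewrite inE => /andP[sm _].
apply/setP => e; rewrite !inE ltnS; have [em|em] := leqP e m; last first.
  by apply/esym/negbTE/negP => /andP[/andP[]]; lia.
rewrite visible_glue // andTb; have [|] := boolP [forall s in S, (e <= s)%N].
  by move=> /forall_inP/(_ s sS) es; rewrite (leq_ltn_trans es sm).
by rewrite !andbF.
Qed.

Lemma card_glue T S : dissection m T -> #|glue (T, S)| = (#|T| + #|S|)%N.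
Proof.
move=> /dissectionP[le _].
have -> : #|S| = #|fan S|.
  have -> : fan S = [set (s, last_vertex) | s in S].
    apply/setP => -[a b]; rewrite !inE /=; apply/andP/imsetP => [[aS /eqP->]|[s sS [-> ->]]].
      by exists a.
    by [].
  by rewrite card_imset // => s s' [].
rewrite cardsU (_ : T :&: fan S = set0) ?cards0 ?subn0 //.
apply/setP => p; rewrite !inE; apply/negbTE/negP => /andP[/le + /andP[_ /eqP e]].
by rewrite e /=; lia.
Qed.

Lemma dissection_sum_step h :
  \sum_(T | dissection m.+1 T) x ^+ #|T| * h #|visibles m.+1 T| =
  \sum_(T | dissection m T) x ^+ #|T| * transfer x h #|visibles m T|.
Proof.
rewrite (reindex_onto glue unglue) /=; last exact: unglueK.
rewrite (eq_bigl (fun p : {set arc} * {set 'I_N.+1} => dissection m p.1 && (p.2 \subset visibles m p.1))); last first.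
  by move=> [T S]; exact: glue_dissection.
rewrite -(pair_big_dep (dissection m) (fun T S => S \subset visibles m T)
  (fun T S => x ^+ #|glue (T, S)| * h #|visibles m.+1 (glue (T, S))|)) /=.
apply: eq_bigr => T dT.
rewrite (bigD1 set0) ?sub0set //= visibles_glue0 // card_glue // cards0 addn0.
rewrite /transfer mulrDr; congr (_ + _); rewrite -fan_sum_subsets big_distrr /=.
apply: eq_bigr => S /andP[SV S0].
by rewrite card_glue // exprD -mulrA visibles_glue.
Qed.

End Step.

(** The recursion starts at the path [0, 1], whose only dissection is empty. *)
Lemma dissection_sum h : (0 < N)%N ->
  \sum_(T | dissection N T) x ^+ #|T| * h #|visibles N T| = iter N.-1 (transfer x) h 1.
Proof.
move=> N0; have step k : (k < N)%N ->
    \sum_(T | dissection N T) x ^+ #|T| * h #|visibles N T| =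
    \sum_(T | dissection (N - k) T) x ^+ #|T| * iter k (transfer x) h #|visibles (N - k) T|.
  elim: k => [|k IH] kN; first by rewrite subn0.
  have e : (N - k = (N - k.+1).+1)%N by lia.
  by rewrite IH ?(ltnW kN) // e dissection_sum_step //; lia.
rewrite (step N.-1); last by rewrite prednK.
have -> : (N - N.-1 = 1)%N by lia.
have d1 T : dissection 1 T = (T == set0).
  apply/dissectionP/eqP => [[le _]|->].
    by apply/setP => p; rewrite inE; apply/negbTE/negP => /le; lia.
  by split=> [p|p q]; rewrite inE.
under eq_bigl do rewrite d1.
rewrite big_pred1_eq cards0 mul1r; congr (iter _ _ _ _).
rewrite (_ : visibles 1 set0 = [set ord0]) ?cards1 //; apply/setP => e; rewrite !inE.
rewrite -val_eqE /= ltnS leqn0; apply/andb_idr => _.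
by apply/visibleP => p; rewrite inE.
Qed.

End PathDissections.

(** * Face numbers *)

Section Adjoint.
Variables (K : comNzRingType) (x : K).
Implicit Types h : nat -> K.

(** The functional [e] precomposed with [transfer x] is
    [g v = e v.-1 + x * c v] with [c v] the sum of the [(1 + x) ^+ (w - v) * e w] for
    [w >= v]. Subtracting [(1 + x) * g v.+1] from [g v] eliminates [c]; the hypothesis
    is this recursion, from which a downward induction recovers [c]. *)
Lemma transfer_adjoint (e g : nat -> K) N h :
    (forall v, g v.+1 = (1 + x) * g v.+2 + e v - e v.+1) ->
    (forall v, (N < v)%N -> e v = 0) -> (forall v, (N.+1 < v)%N -> g v = 0) ->
  \sum_(0 <= v < N.+1) e v * transfer x h v = \sum_(1 <= v < N.+2) g v * h v.
Proof.
move=> rec e0 g0.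
suff [c [_ ->]] : exists c, g 1%N = e 0%N + x * c /\ \sum_(1 <= v < N.+2) g v * h v =
    \sum_(0 <= v < N.+1) e v * transfer x h v - (e 0%N + (1 + x) * c) * fan_sum x h 0.
  by rewrite mulr0 subr0.
have main k j : (j + k = N.+1)%N -> exists c, g j.+1 = e j + x * c /\
    \sum_(j.+1 <= v < N.+2) g v * h v =
    \sum_(j <= v < N.+1) e v * transfer x h v - (e j + (1 + x) * c) * fan_sum x h j.
  elim: k j => [|k IH] j jk.
    rewrite addn0 in jk; rewrite jk; exists 0; rewrite g0 // e0 // !big_geq //.
    by split; ring.
  have [|c [gj sj]] := IH j.+1; first by rewrite addSnnS.
  exists (e j.+1 + (1 + x) * c); split; first by rewrite rec gj; ring.
  rewrite big_ltn; last by lia.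
  rewrite sj.
  rewrite [X in _ = X - _]big_ltn; last by lia.
  by rewrite rec gj /transfer /=; ring.
exact: (main N.+1 0%N).
Qed.

End Adjoint.

(** For [v >= 2], the number of noncrossing families of [k] symmetric pairs of diagonals
    of the [2n]-gon that leave [v] diameters free. For [v >= 1], [v * dissection_count n k v] is
    [n] times the number of dissections of the path [0, ..., n] with [k] arcs and
    [v] visible vertices before [n]. *)
Definition dissection_count (n k v : nat) : nat :=
  'C(n.-1 + k, k) * (if k is k'.+1 then (v < n)%N * 'C(n - v.+1, k') else v == n).

Local Notation dc := dissection_count.

Lemma natr_mul_bin_left (m k : nat) :
  k.+1%:R * 'C(m, k.+1)%:R = (m%:R - k%:R) * 'C(m, k)%:R :> rat.
Proof.
have [le|lt] := leqP k m; last by rewrite !bin_small ?mulr0 // ltnW.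
by rewrite -natrB // -!natrM mul_bin_left.
Qed.

Lemma dissection_count0 n v : dc n 0 v = (v == n).
Proof. by rewrite /dc bin0 mul1n. Qed.

Lemma dissection_count_ge n k v : (n <= v)%N -> dc n k.+1 v = 0%N.
Proof. by move=> nv; rewrite /dc ltnNge nv muln0. Qed.

Lemma dissection_count_lt v d k :
  dc (v + d).+1 k.+1 v = ('C(v + d + k.+1, k.+1) * 'C(d, k))%N.
Proof. by rewrite /dc ltnS leq_addr mul1n subSS addKn. Qed.

(** After division by [n * n.+1], this is the recursion of [transfer_adjoint] for the
    numbers of path dissections, read off at the coefficient [k]. *)
Lemma dissection_count_rec (n k v : nat) : (0 < n)%N ->
  n%:R * (v.+1%:R * (dc n.+1 k v.+1)%:R) =
  n%:R * (v.+2%:R * (dc n.+1 k v.+2)%:R) +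
  (if k is k'.+1 then n%:R * (v.+2%:R * (dc n.+1 k' v.+2)%:R) else 0) +
  n.+1%:R * (v%:R * (dc n k v)%:R) - n.+1%:R * (v.+1%:R * (dc n k v.+1)%:R) :> rat.
Proof.
move=> n0; case: k => [|k].
  rewrite !dissection_count0 !eqSS.
  have [->|vn] := eqVneq v n; first by rewrite !gtn_eqF //=; ring.
  by have [<-|vn'] := eqVneq v.+1 n; rewrite /=; ring.
have [nv|] := leqP n v.
  rewrite !dissection_count_ge; try lia.
  have -> : dc n.+1 k v.+2 = 0%N.
    case: k => [|k]; first by rewrite dissection_count0 gtn_eqF.
    by rewrite dissection_count_ge // leqW.
  by ring.
rewrite leq_eqVlt => /orP[/eqP <-|vn].
  have E m j : dc m.+1 j.+1 m = ('C(m + j.+1, j.+1) * (j == 0))%N.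
    by have := dissection_count_lt m 0 j; rewrite addn0 => ->; rewrite bin0n.
  rewrite !E !(@dissection_count_ge _ k) //.
  case: k => [|k]; last first.
    by rewrite (@dissection_count_ge _ k) //= !muln0; ring.
  by rewrite dissection_count0 !eqxx !bin1 /= !muln1; ring.
have [d ->] : exists d, n = (v + d).+2 by exists (n - v.+2)%N; lia.
have E1 j : dc (v + d).+3 j.+1 v.+1 = ('C((v + d).+2 + j.+1, j.+1) * 'C(d.+1, j))%N.
  by have := dissection_count_lt v.+1 d.+1 j; rewrite addSn addnS.
have E2 j : dc (v + d).+3 j.+1 v.+2 = ('C((v + d).+2 + j.+1, j.+1) * 'C(d, j))%N.
  by have := dissection_count_lt v.+2 d j; rewrite !addSn.
have E3 j : dc (v + d).+2 j.+1 v = ('C((v + d).+1 + j.+1, j.+1) * 'C(d.+1, j))%N.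
  by have := dissection_count_lt v d.+1 j; rewrite addnS.
have E4 j : dc (v + d).+2 j.+1 v.+1 = ('C((v + d).+1 + j.+1, j.+1) * 'C(d, j))%N.
  by have := dissection_count_lt v.+1 d j; rewrite addSn.
case: k => [|k].
  by rewrite E1 E2 E3 E4 dissection_count0 !bin1 !bin0 ltn_eqF ?ltnS ?leq_addr //=; ring.
rewrite E1 !E2 E3 E4 binS !natrM natrD.
set A := 'C((v + d).+1 + k.+2, k.+2)%:R.
have hB : (v + d).+2%:R * 'C((v + d).+2 + k.+2, k.+2)%:R =
    ((v + d).+2%:R + k.+2%:R) * A :> rat.
  have := mul_bin_down ((v + d).+2 + k.+2) k.+2.
  by rewrite addnK => /(congr1 (fun z => z%:R : rat)); rewrite !natrM natrD => <-.
have hG : (v + d).+2%:R * 'C((v + d).+2 + k.+1, k.+1)%:R = k.+2%:R * A :> rat.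
  have -> : ((v + d).+2 + k.+1 = (v + d).+1 + k.+2)%N by lia.
  by rewrite natr_mul_bin_left natrD; ring.
have hD := natr_mul_bin_left d k.
have {}hB := congr1 (fun z => z - ((v + d).+2%:R + k.+2%:R) * A) hB.
have {}hG := congr1 (fun z => z - k.+2%:R * A) hG.
have {}hD := congr1 (fun z => z - (d%:R - k%:R) * 'C(d, k)%:R) hD.
rewrite /= subrr in hB; rewrite /= subrr in hG; rewrite /= subrr in hD.
apply/eqP; rewrite -subr_eq0; apply/eqP.
set B := 'C((v + d).+2 + k.+2, k.+2)%:R in hB *.
set G := 'C((v + d).+2 + k.+1, k.+1)%:R in hG *.
set D := 'C(d, k.+1)%:R in hD *; set D1 := 'C(d, k)%:R in hD *.
transitivity ((v.+1%:R * (D + D1) - v.+2%:R * D) *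
    ((v + d).+2%:R * B - ((v + d).+2%:R + k.+2%:R) * A) -
  v.+2%:R * D1 * ((v + d).+2%:R * G - k.+2%:R * A) -
  A * (k.+1%:R * D - (d%:R - k%:R) * D1)); first by ring.
by rewrite hB hG hD !mulr0 !subr0.
Qed.

Definition dissection_poly (n v : nat) : {poly rat} :=
  \poly_(k < n.+1) (dc n k v)%:R.

Lemma coef_dissection_poly n v k : (0 < n)%N -> (dissection_poly n v)`_k = (dc n k v)%:R.
Proof.
case: n => // n _; rewrite coef_poly; case: ltnP => //; case: k => // k nk.
have [le|lt] := leqP n.+1 v; first by rewrite dissection_count_ge.
have [d nE] : exists d, n = (v + d)%N by exists (n - v)%N; lia.
by rewrite nE dissection_count_lt (@bin_small d k) ?muln0 //; lia.
Qed.

Lemma dissection_poly_rec n v : (0 < n)%N ->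
  let g v := n%:R * (v%:R * dissection_poly n.+1 v) in
  let e v := n.+1%:R * (v%:R * dissection_poly n v) in
  g v.+1 = (1 + 'X) * g v.+2 + e v - e v.+1.
Proof.
move=> n0; apply/polyP => k; rewrite /= mulrDl mul1r.
have cf (m j : nat) (p : {poly rat}) i :
    (m%:R * (j%:R * p))`_i = m%:R * (j%:R * p`_i).
  by rewrite !mulr_natl !coefMn.
rewrite coefB !coefD coefXM !cf !coef_dissection_poly //.
by rewrite dissection_count_rec //; case: k.
Qed.

(** By induction on [n]: the weights [v * dissection_poly n v] are carried to those of
    [n.+1] by the adjoint of [transfer], up to the factors [n] and [n.+1]. *)
Theorem iter_transfer n (h : nat -> {poly rat}) : (0 < n)%N ->
  n%:R * iter n.-1 (transfer 'X) h 1 = \sum_(1 <= v < n.+1) v%:R * dissection_poly n v * h v.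
Proof.
case: n => // n _; elim: n h => [|n IH] h.
  rewrite big_nat1 !mul1r (_ : dissection_poly 1 1 = 1) ?mul1r //.
  apply/polyP => k; rewrite coef_dissection_poly // coef1.
  by case: k => [|k]; rewrite ?dissection_count0 ?dissection_count_ge.
have nz m : m.+1%:R != 0 :> {poly rat} by rewrite -polyC_natr polyC_eq0 pnatr_eq0.
apply: (mulfI (nz n)); rewrite mulrCA /= -iterS iterSr IH.
have zero m v : (m.+1 < v)%N -> dissection_poly m.+1 v = 0.
  move=> mv; apply/polyP => k; rewrite coef_dissection_poly // coef0.
  case: k => [|k]; last by rewrite dissection_count_ge // ltnW.
  by rewrite dissection_count0 gtn_eqF.
pose e v : {poly rat} := n.+2%:R * (v%:R * dissection_poly n.+1 v).
pose g v : {poly rat} := n.+1%:R * (v%:R * dissection_poly n.+2 v).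
have adj : \sum_(0 <= v < n.+2) e v * transfer 'X h v = \sum_(1 <= v < n.+3) g v * h v.
  apply: transfer_adjoint => v; first exact: dissection_poly_rec.
    by move=> /zero; rewrite /e => ->; rewrite !mulr0.
  by move=> /zero; rewrite /g => ->; rewrite !mulr0.
rewrite big_ltn // {1}/e mulr0n mul0r mulr0 mul0r add0r in adj.
rewrite !big_distrr /=; move: adj; rewrite /e /g.
under eq_bigr do rewrite -mulrA.
by under [X in _ = X -> _]eq_bigr do rewrite -mulrA.
Qed.

(** Both sides count the subsets with [r + s.+1] elements of a set of [n] integers,
    according to their element number [r]. *)
Lemma sum_bin_mul r s n : (\sum_(0 <= v < n) 'C(v, r) * 'C(n - v.+1, s) = 'C(n, r + s.+1))%N.
Proof.
elim: n s => [|n IH] s; first by rewrite big_geq // addnS bin0n.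
rewrite big_nat_recr //= subnn bin0n.
case: s => [|s].
  rewrite muln1 addn1 binS -(addn1 r) -(IH 0%N); congr (_ + _)%N.
  apply: eq_big_nat => v vn.
  by rewrite !bin0.
rewrite muln0 addn0 addnS binS -IH -addnS -IH -big_split /=.
apply: eq_big_nat => v vn; rewrite -mulnDr -binS; congr (_ * 'C(_, _))%N; lia.
Qed.

Lemma sum_dissection_count n k r : (0 < n)%N ->
  (\sum_(0 <= v < n.+1) dc n k v * 'C(v, r) = 'C(n.-1 + k, k) * 'C(n, k + r))%N.
Proof.
move=> n0; rewrite big_nat_recr //=; case: k => [|k].
  rewrite dissection_count0 eqxx mul1n bin0 mul1n add0n.
  rewrite big_nat big1 ?add0n // => v /andP[_ vn].
  by rewrite dissection_count0 ltn_eqF.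
rewrite dissection_count_ge // mul0n addn0 (addnC k.+1 r) -sum_bin_mul.
rewrite big_distrr /=; apply: eq_big_nat => v /andP[_ vn].
by rewrite /dc vn mul1n -mulnA [X in (_ * X)%N]mulnC.
Qed.

(** The generating polynomial of the cliques of coloured diameters supported on a set
    of [c] diameters; see [sum_bicoloured]. *)
Definition diameter_weight (c : nat) : {poly rat} := (1 + 'X) ^+ c *+ 2 - 1 + 'X^2 *+ c.

Lemma coef_1DXn (K : comNzRingType) c k : ((1 + 'X : {poly K}) ^+ c)`_k = 'C(c, k)%:R.
Proof.
rewrite exprDn coef_sum.
under eq_bigr do rewrite expr1n mul1r coefMn coefXn.
have [kc|kc] := ltnP k c.+1; last first.
  rewrite bin_small // big1 // => i _; rewrite gtn_eqF ?mul0rn //.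
  exact: leq_trans (ltn_ord i) kc.
rewrite (bigD1 (Ordinal kc)) //= eqxx big1 ?addr0 // => i ik.
by rewrite eq_sym; move: ik; rewrite -val_eqE /= => /negbTE ->; rewrite mul0rn.
Qed.

(** The sum starts at [v = 2] since every noncrossing family leaves two diameters
    free. *)
Definition clique_count (n k : nat) : rat :=
  (\sum_(2 <= v < n.+1) dissection_poly n v * diameter_weight v)`_k.

Lemma coef_dissection_weight n v k : (0 < n)%N ->
  (dissection_poly n v * diameter_weight v)`_k =
  2 * \sum_(0 <= i < k.+1) (dc n i v * 'C(v, k - i))%:R - (dc n k v)%:R +
  (if k is k'.+2 then (dc n k' v * 'C(v, 1))%:R else 0) :> rat.
Proof.
move=> n0; rewrite /diameter_weight mulrDr mulrBr mulr1 !mulrnAr coefD coefB !coefMn.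
rewrite (coef_dissection_poly v k n0); congr (_ - _ + _).
  rewrite [RHS]mulr_natl; congr (_ *+ _); rewrite coefM big_mkord; apply: eq_bigr => i _.
  by rewrite coef_dissection_poly // coef_1DXn natrM.
rewrite coefMXn; case: k => [|[|k]] /=; rewrite ?mul0rn //.
by rewrite !subSS subn0 coef_dissection_poly // bin1 natrM mulr_natr.
Qed.

Lemma sum_bin_hockey n k :
  (\sum_(0 <= i < k.+1) 'C(n + i, i) = 'C(n.+1 + k, k))%N.
Proof.
elim: k => [|k IH]; first by rewrite big_nat1 !bin0.
by rewrite big_nat_recr //= IH [in RHS]addSn binS addSnnS addnC.
Qed.

Lemma sum2_dissection_count n k r : (2 <= n)%N ->
  \sum_(2 <= v < n.+1) (dc n k v * 'C(v, r))%:R =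
  ('C(n.-1 + k, k) * 'C(n, k + r))%:R - ((r == 0) * dc n k 0)%:R
   - ((r <= 1)%N * dc n k 1)%:R :> rat.
Proof.
move=> n2; rewrite -sum_dissection_count; last by lia.
rewrite [in RHS]big_ltn // [in RHS]big_ltn; last by lia.
rewrite !natrD natr_sum.
have -> : 'C(0, r) = (r == 0) by rewrite bin0n.
have -> : 'C(1, r) = (r <= 1)%N by case: r => [|[|r]].
rewrite [(dc n k 0 * _)%N]mulnC [(dc n k 1 * _)%N]mulnC; ring.
Qed.

Lemma clique_countE n k : (2 <= n)%N ->
  clique_count n k =
  2 * \sum_(0 <= i < k.+1) (('C(n.-1 + i, i) * 'C(n, k))%:R -
     ((k == i) * dc n i 0)%:R - ((k <= i.+1)%N * dc n i 1)%:R)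
  - (('C(n.-1 + k, k) * 'C(n, k))%:R - (dc n k 0)%:R - (dc n k 1)%:R) +
  (if k is k'.+2 then ('C(n.-1 + k', k') * 'C(n, k'.+1))%:R - (dc n k' 1)%:R else 0).
Proof.
move=> n2; have n0 : (0 < n)%N by lia.
rewrite /clique_count coef_sum.
under eq_bigr do rewrite coef_dissection_weight //.
rewrite big_split /= sumrB -mulr_sumr exchange_big_nat /=; congr (2 * _ - _ + _).
- apply: eq_big_nat => i /andP[_ ik]; rewrite sum2_dissection_count // subnKC //.
  by rewrite subn_eq0 leq_subLR addn1; congr (_ - (_ * _)%:R - _); congr nat_of_bool; lia.
- have := @sum2_dissection_count n k 0 n2; rewrite addn0 /= !mul1n => <-.
  by apply: eq_bigr => v _; rewrite bin0 muln1.
case: k => [|[|k]]; [by rewrite big1 | by rewrite big1 |].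
by rewrite /= sum2_dissection_count //= mul0n mul1n subr0 addn1.
Qed.

Lemma clique_count0 n : (2 <= n)%N -> clique_count n 0 = 1.
Proof.
move=> n2; rewrite clique_countE // big_nat1 !dissection_count0 !bin0 /=.
have [-> ->] : (0 == n) = false /\ (1 == n) = false by split; lia.
by rewrite /= ?muln0 ?mul1n; ring.
Qed.

Lemma clique_count1 n : (2 <= n)%N -> clique_count n 1 = n%:R ^+ 2.
Proof.
case: n => [|[|n]] // _; rewrite clique_countE // !big_nat_recl // big_geq //=.
rewrite !dissection_count0 /dc /= !bin0 !bin1; ring.
Qed.

Lemma clique_count_large n k : (2 <= n)%N -> clique_count n k.+2 =
  2 * ('C(n + k.+1, k.+1) * 'C(n, k.+2))%:R + ('C(n.-1 + k.+2, k.+2) * 'C(n, k.+2))%:R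
  - 2 * (dc n k.+1 1)%:R - (dc n k.+2 0)%:R - (dc n k.+2 1)%:R
  + ('C(n.-1 + k, k) * 'C(n, k.+1))%:R - (dc n k 1)%:R.
Proof.
move=> n2; rewrite clique_countE // big_nat_recr //= big_nat_recr //=.
rewrite eqxx leqnSn !mul1n.
have -> : (k.+2 == k.+1) = false by lia.
rewrite leqnn mul1n mul0n subr0.
rewrite (eq_big_nat _ _ (F2 := fun i => ('C(n.-1 + i, i))%:R * ('C(n, k.+2))%:R)); last first.
  move=> i /andP[_ ik]; have -> : (k.+2 == i) = false by lia.
  have -> : (k.+2 <= i.+1)%N = false by lia.
  by rewrite !mul0n !subr0 natrM.
rewrite -mulr_suml -natr_sum.
have := sum_bin_hockey n.-1 k.+1; rewrite prednK; last by lia.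
rewrite big_nat_recr //= => /(congr1 (fun z => z%:R : rat)); rewrite natrD => e.
rewrite [in RHS]natrM -e !natrM; ring.
Qed.

(** By absorption identities, all binomial coefficients of [clique_count_large] are
    rational multiples of [C(N + 1 + k, k)] or of [C(N, k)], apart from [C(N, k - 1)]
    which cancels. *)
Theorem clique_count_closed N k :
  N.+1%:R * clique_count N.+2 k =
  'C(N.+2, k)%:R * (N.+1%:R * 'C(N.+2 + k, k)%:R - k%:R * 'C(N + k, k)%:R).
Proof.
case: k => [|[|k]].
- by rewrite clique_count0 // !bin0; ring.
- by rewrite clique_count1 // !bin1 !natrD; ring.
have E0 j : dc N.+2 j.+1 0 = ('C(N.+1 + j.+1, j.+1) * 'C(N.+1, j))%N.
  exact: dissection_count_lt 0 N.+1 j.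
have E1 j : dc N.+2 j.+1 1 = ('C(N.+1 + j.+1, j.+1) * 'C(N, j))%N.
  exact: dissection_count_lt 1 N j.
rewrite clique_count_large // E0 !E1 /=.
have -> : dc N.+2 k 1 = ('C(N.+1 + k, k) * (if k is k'.+1 then 'C(N, k') else 0))%N.
  by case: k => [|k]; rewrite ?E1 ?dissection_count0 ?muln0.
have nz m : m.+1%:R != 0 :> rat by rewrite pnatr_eq0.
have inv (m : nat) (x y : rat) : m.+1%:R * x = y -> x = y / m.+1%:R.
  by move=> <-; rewrite mulrC mulKf.
set D := 'C(N, k)%:R : rat.
have D2 : 'C(N, k.+1)%:R = (N%:R - k%:R) * D / k.+1%:R.
  by apply: inv; rewrite natr_mul_bin_left.
have D3 : 'C(N, k.+2)%:R = (N%:R - k.+1%:R) * 'C(N, k.+1)%:R / k.+2%:R :> rat.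
  by apply: inv; rewrite natr_mul_bin_left.
set A := 'C(N.+1 + k, k)%:R : rat.
have A1 : 'C(N.+2 + k, k.+1)%:R = (N%:R + 2 + k%:R) * A / k.+1%:R.
  by apply: inv; rewrite /A -natrM -mul_bin_diag natrM !addSn /=; ring.
have A2 : 'C(N.+3 + k, k.+2)%:R = (N%:R + 3 + k%:R) * 'C(N.+2 + k, k.+1)%:R / k.+2%:R :> rat.
  by apply: inv; rewrite -natrM -mul_bin_diag natrM !addSn /=; ring.
have G : 'C(N.+3 + k, k.+1)%:R = k.+2%:R * 'C(N.+3 + k, k.+2)%:R / N.+2%:R :> rat.
  by apply: inv; rewrite natr_mul_bin_left natrD; ring.
have H : 'C(N + k.+2, k.+2)%:R = 'C(N.+3 + k, k.+2)%:R - 'C(N.+2 + k, k.+1)%:R :> rat.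
  by rewrite !addSn binS natrD !addnS addrK.
have -> : (N.+2 + k.+1 = N.+3 + k)%N by lia.
have -> : (N.+1 + k.+2 = N.+3 + k)%N by lia.
have -> : (N.+1 + k.+1 = N.+2 + k)%N by lia.
have -> : 'C(N.+2 + k.+2, k.+2) = ('C(N.+3 + k, k.+2) + 'C(N.+3 + k, k.+1))%N.
  by rewrite -binS; congr 'C(_, _); lia.
have -> : 'C(N.+2, k.+2) = ('C(N, k.+2) + 2 * 'C(N, k.+1) + 'C(N, k))%N.
  by rewrite !binS; lia.
pose q := if k is k'.+1 then 'C(N, k') else 0%N; rewrite -/q.
have -> : 'C(N.+2, k.+1) = ('C(N, k.+1) + 2 * 'C(N, k) + q)%N.
  by rewrite !binS {}/q; case: k {D A D2 D3 A1 A2 G H} => [|k]; rewrite ?bin0 ?binS; lia.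
rewrite (binS N k).
move: D2 D3 A1 A2 G H; rewrite /D /A {D A E0 E1}.
(* The binomials are generalized so that the casts do not unfold them. *)
move: 'C(N + k.+2, k.+2) 'C(N.+3 + k, k.+2) 'C(N.+3 + k, k.+1) 'C(N.+2 + k, k.+1)
  'C(N.+1 + k, k) 'C(N, k.+2) 'C(N, k.+1) 'C(N, k) q => c1 c2 c3 c4 c5 c6 c7 c8 q.
move=> D2 D3 A1 A2 G H; rewrite !(natrM, natrD) H G A2 A1 D3 D2.
field.
by rewrite nat1r -!natrD !pnatr_eq0.
Qed.

(** * Compatible facet labels *)

Section Labels.
Variables (n : nat) (hn : (2 <= n)%N) (R : realType).

Local Notation vtx := (vtx hn).
Local Notation diag := (polygon_diag hn).

Definition disjoint_interiors (A B : {set 'I_(n.*2)}) : Prop :=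
  (@diagonal_interior n R A `&` @diagonal_interior n R B = classical_sets.set0)%classic.

Lemma disjoint_interiorsC A B : disjoint_interiors A B -> disjoint_interiors B A.
Proof. by rewrite /disjoint_interiors classical_sets.setIC. Qed.

(** A diagonal with its image under the central symmetry, which adds [n] to the
    indices. *)
Definition pairset (a b : nat) : {set {set 'I_(n.*2)}} :=
  [set diag a b; diag (a + n) (b + n)].

Lemma vtx_congr a b : a = b %[mod n.*2] -> vtx a = vtx b.
Proof. by move=> e; apply/eqP; rewrite vtx_eq e. Qed.

Lemma diagC a b : diag a b = diag b a.
Proof. by rewrite /polygon_diag finset.setUC. Qed.

Lemma diag_congr a b c d : a = c %[mod n.*2] -> b = d %[mod n.*2] ->
  diag a b = diag c d.
Proof. by move=> ac bd; rewrite /polygon_diag (vtx_congr ac) (vtx_congr bd). Qed.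

Lemma pairset_congr a b c d : a = c %[mod n.*2] -> b = d %[mod n.*2] ->
  pairset a b = pairset c d.
Proof.
move=> ac bd; rewrite /pairset (diag_congr ac bd).
by congr [set _; _]; apply: diag_congr; apply/eqP; rewrite eqn_modDr; apply/eqP.
Qed.

Lemma pairset_shift a b : pairset (a + n) (b + n) = pairset a b.
Proof.
rewrite /pairset finset.setUC; congr [set _; _]; apply: diag_congr;
by rewrite -addnA addnn modnDr.
Qed.

Lemma antipodeE z : antipode (vtx z) = vtx (z + n).
Proof.
suff H k : iter k (@ordS n.*2) (vtx z) = vtx (z + k) by exact: H.
elim: k => [|k IH]; first by rewrite addn0.
rewrite iterS IH; apply/val_inj => /=.
by rewrite -[in LHS]addn1 modnDml addn1 addnS.
Qed.

Lemma antipode_diag a b : @antipode n @: diag a b = diag (a + n) (b + n).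
Proof. by rewrite /polygon_diag imsetU1 imset_set1 !antipodeE. Qed.

Lemma ordS_vtx z : ordS (vtx z) = vtx z.+1.
Proof. by apply/val_inj; rewrite /= -addn1 modnDml addn1. Qed.

Lemma diag_is_diagonal a b : (a + 2 <= b)%N -> (b + 2 <= a + n.*2)%N ->
  is_diagonal (diag a b).
Proof.
move=> ab ba; apply/existsP; exists (vtx a); apply/existsP; exists (vtx b).
rewrite eqxx !ordS_vtx vtx_neq /=; last by lia.
rewrite eq_sym vtx_neq /=; last by lia.
by rewrite -(vtxD hn a) eq_sym vtx_neq //; lia.
Qed.

Lemma diag_is_diameter z : is_diameter (diag z (z + n)).
Proof.
rewrite /is_diameter diag_is_diagonal; [|lia..].
by apply/existsP; exists (vtx z); rewrite antipodeE.
Qed.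

Definition axis z : diameter n := exist (@is_diameter n) _ (diag_is_diameter z).

Lemma diag_eq a b c d : diag a b = diag c d ->
  [\/ a = c %[mod n.*2] /\ b = d %[mod n.*2] |
      a = d %[mod n.*2] /\ b = c %[mod n.*2]].
Proof.
move=> e; have mem z : (z == a %[mod n.*2]) || (z == b %[mod n.*2]) =
    (z == c %[mod n.*2]) || (z == d %[mod n.*2]).
  by have /setP/(_ (vtx z)) := e; rewrite !inE !vtx_eq.
have := mem a; have := mem b; have := mem c; have := mem d.
rewrite !eqxx !orbT /=.
move=> hd hc hb ha; case/orP: (esym ha) => /eqP ea; case/orP: (esym hb) => /eqP eb.
- by case/orP: hd => /eqP ed; left; split => //; rewrite ed ?eb ?ea.
- by left.
- by right.
- by case/orP: hc => /eqP ec; right; split => //; rewrite ec ?eb ?ea.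
Qed.

Lemma diag_not_diameter a b : (a < b < a + n.*2)%N -> (b != a + n)%N ->
  ~~ is_diameter (diag a b).
Proof.
move=> ab abn; rewrite negb_and; apply/orP; right; apply/existsPn => u.
apply/eqP; rewrite -(vtx_val hn u) antipodeE => /diag_eq.
have h2 : (n + n = n.*2)%N by rewrite addnn.
case=> -[e1 e2].
  have : b = a + n %[mod n.*2] by rewrite e2 -modnDml -e1 modnDml.
  move=> {e1 e2}; have [le|lt] := leqP b (a + n).
    by move/esym/eqP; rewrite eqn_mod_dvd // gtnNdvd //; lia.
  by move/eqP; rewrite eqn_mod_dvd ?(ltnW lt) // gtnNdvd //; lia.
have : a = b + n %[mod n.*2] by rewrite e1 -modnDml -e2 modnDml.
move=> {e1 e2} /esym/eqP; rewrite eqn_mod_dvd; last by lia.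
have -> : (b + n - a = n.*2 + (b - a) - n)%N by lia.
have [le|lt] := leqP n (b - a).
  by rewrite -addnBA // dvdn_addr // gtnNdvd //; lia.
by rewrite gtnNdvd //; lia.
Qed.

Lemma pairset_is_diag_pair a l : (2 <= l < n)%N -> is_diag_pair (pairset a (a + l)).
Proof.
move=> hl; apply/existsP; exists (diag a (a + l)).
rewrite diag_is_diagonal ?diag_not_diameter ?antipode_diag ?eqxx //; lia.
Qed.

Lemma diag_pairP (t : diag_pair n) :
  exists a l, (2 <= l < n)%N /\ val t = pairset a (a + l).
Proof.
case: t => e /= /existsP[D /and3P[/existsP[u /existsP[w /and4P[/eqP DE uw wu' uw']]] nd /eqP->]].
wlog lt : u w DE uw wu' uw' / (u < w)%N.
  move=> H; have [lt|gt|e'] := ltngtP (u : nat) w; first exact: (H u w).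
    by apply: (H w u) => //; rewrite ?DE 1?finset.setUC 1?eq_sym.
  by move: uw; rewrite -val_eqE /= e' eqxx.
have := ltn_ord w; have := ltn_ord u.
have {}DE : D = diag u w by rewrite /polygon_diag !vtx_val.
have {}wu' : (w : nat) != (u : nat).+1.
  apply: contra wu' => /eqP e'; rewrite -(vtx_val hn u) ordS_vtx -e' vtx_val //.
have {}uw' : (u != 0 :> nat) || ((w : nat).+1 != n.*2).
  rewrite -negb_and; apply: contra uw' => /andP[/eqP e1 /eqP e2].
  by apply/eqP/val_inj; rewrite /= e2 modnn.
have {}nd : (w : nat) != (u + n)%N.
  by apply: contra nd => /eqP e'; rewrite DE e' diag_is_diameter.
move=> hu hw; have [lt'|ge'] := ltnP (w - u) n.
  exists (u : nat), (w - u)%N; split; first by lia.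
  by rewrite DE antipode_diag subnKC // ltnW.
exists (w : nat), (u + n.*2 - w)%N; split; first by lia.
rewrite subnKC; last by lia.
rewrite DE antipode_diag diagC [diag (u + n) _]diagC /pairset.
by congr [set _; _]; apply: diag_congr; rewrite ?modnDr // addnAC modnDr.
Qed.

(** Exactly one of the two symmetric diagonals has its first end in the half-turn
    that starts at [v]. *)
Lemma diag_pair_frame v (t : diag_pair n) :
  exists z l, [/\ (z < n)%N, (2 <= l < n)%N & val t = pairset (v + z) (v + z + l)].
Proof.
have [a [l [hl ->]]] := diag_pairP t.
have n0 : (0 < n.*2)%N by rewrite double_gt0 ltnW.
pose z := ((a + (n.*2 - v %% n.*2)) %% n.*2)%N.
have za : v + z = a %[mod n.*2].
  rewrite modnDmr -modnDml addnCA subnKC ?modnDr //.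
  by rewrite ltnW // ltn_mod.
have zl : v + z + l = a + l %[mod n.*2] by apply/eqP; rewrite eqn_modDr; apply/eqP.
have zn : (z < n.*2)%N by rewrite ltn_mod.
move: z za zl zn => z za zl zn; have [lt|ge] := ltnP z n.
  by exists z, l; split => //; apply: pairset_congr.
exists (z - n)%N, l; split => //; first by lia.
rewrite -[RHS]pairset_shift; apply: pairset_congr; rewrite -?za -?zl;
congr modn; clear za zl; lia.
Qed.

Lemma diameter_frame v (d : diameter n) : exists2 e, (e < n)%N &
  val d = diag (v + e) (v + e + n).
Proof.
case: d => d /= /andP[_ /existsP[u /eqP->]].
have n0 : (0 < n.*2)%N by rewrite double_gt0 ltnW.
pose z := ((u + (n.*2 - v %% n.*2)) %% n.*2)%N.
have zn : (z < n.*2)%N by rewrite ltn_mod.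
have za : v + z = u %[mod n.*2].
  rewrite modnDmr -modnDml addnCA subnKC ?modnDr //.
  by rewrite ltnW // ltn_mod.
have uE : [set u; antipode u] = diag (v + z) (v + z + n).
  by rewrite -(vtx_val hn u) antipodeE -/(diag _ _); apply: diag_congr;
    [|apply/eqP; rewrite eqn_modDr; apply/eqP].
move: z za zn uE => z za zn uE; have [lt|ge] := ltnP z n; first by exists z.
exists (z - n)%N; first by lia.
rewrite uE diagC; apply: diag_congr; last by congr modn; clear za uE; lia.
by rewrite -(modnDr (v + (z - n))); congr modn; clear za uE; lia.
Qed.

Lemma disjoint_beside v a b c d : (a < b)%N -> (b <= c)%N -> (c < d)%N ->
    (d <= a + n.*2)%N -> (b, a + n.*2)%N != (c, d) ->
  disjoint_interiors (diag (v + a) (v + b)) (diag (v + c) (v + d)).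
Proof.
move=> ab bc cd da ne.
have -> : diag (v + a) (v + b) = diag (v + b) (v + (a + n.*2)).
  by rewrite diagC; apply: diag_congr; rewrite // addnA modnDr.
apply: diagonals_disjoint; rewrite ?leq_add2l ?ltn_add2l //; first by lia.
by move: ne; rewrite !xpair_eqE !eqn_add2l.
Qed.

Lemma disjoint_inside v a b c d : (a < b < a + n.*2)%N -> (a <= c)%N -> (c < d)%N ->
  (d <= b)%N -> (a, b) != (c, d) -> disjoint_interiors (diag (v + a) (v + b)) (diag (v + c) (v + d)).
Proof.
move=> ab ac cd db ne.
apply: diagonals_disjoint; rewrite ?leq_add2l ?ltn_add2l //; first by lia.
by move: ne; rewrite !xpair_eqE !eqn_add2l.
Qed.

Lemma not_disjoint v a b c d : (a < c)%N -> (c < b)%N -> (b < d)%N -> (d < a + n.*2)%N ->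
  ~ disjoint_interiors (diag (v + a) (v + b)) (diag (v + c) (v + d)).
Proof.
move=> ac cb bd da; have [||||p hp] := @diagonals_meet n hn R (v + a) (v + b) (v + c) (v + d).
1-4: lia.
by rewrite /disjoint_interiors => e; rewrite e in hp.
Qed.

(** Within the half-turn, noncrossing arcs are nested or side by side; an arc and
    the opposite of another one are always side by side. *)
Lemma compatible_diag (t t' : diag_pair n) v a b c d :
    (a < b <= n)%N -> (c < d <= n)%N -> (a, b) != (0, n)%N -> (c, d) != (0, n)%N ->
    (a, b) != (c, d) ->
    val t = pairset (v + a) (v + b) -> val t' = pairset (v + c) (v + d) ->
  compatible R (inl t) (inl t') <-> ~~ crossing a b c d.
Proof.
move=> ab cd ab0 cd0 ne tE t'E; rewrite /compatible /diagonals_of tE t'E; split.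
  move=> h; apply/negP => /orP[]/andP[/andP[x y] z].
    have := h _ _ (set21 _ _) (set21 _ _); apply: not_disjoint => //; lia.
  have := h _ _ (set21 _ _) (set21 _ _) => /disjoint_interiorsC; apply: not_disjoint => //; lia.
move=> nc.
have same w : disjoint_interiors (diag (w + a) (w + b)) (diag (w + c) (w + d)).
  have [bc|cb] := leqP b c.
    by apply: disjoint_beside => //; rewrite ?xpair_eqE; lia.
  have [da|ad] := leqP d a.
    by apply: disjoint_interiorsC; apply: disjoint_beside => //; rewrite ?xpair_eqE; lia.
  have [/andP[ac db]|out] := boolP ((a <= c) && (d <= b))%N.
    by apply: disjoint_inside => //; lia.
  apply: disjoint_interiorsC; apply: disjoint_inside => //; rewrite ?[(c, d) == _]eq_sym //; try lia;
  by move: nc out; rewrite /crossing; lia.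
have opp w a' b' c' d' : (a' < b' <= n)%N -> (c' < d' <= n)%N -> (a', b') != (0, n)%N ->
    disjoint_interiors (diag (w + a') (w + b')) (diag (w + c' + n) (w + d' + n)).
  move=> ab' cd' ne0; rewrite -!(addnA w); apply: disjoint_beside => //; try lia.
  by move: ne0; rewrite !xpair_eqE; lia.
move=> A B; rewrite !inE => /orP[]/eqP-> /orP[]/eqP->.
- exact: same.
- exact: opp.
- by apply: disjoint_interiorsC; apply: opp.
- by rewrite -!addnA ![(_ + n)%N]addnC !addnA; exact: same.
Qed.

Lemma compatible_diameter (t : diag_pair n) col (d : diameter n) v a b e :
    (a < b <= n)%N -> (a, b) != (0, n)%N -> (e < n)%N ->
    val t = pairset (v + a) (v + b) -> val d = diag (v + e) (v + e + n) ->
  compatible R (inl t) (inr (col, d)) <-> ~~ ((a < e) && (e < b))%N.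
Proof.
move=> ab ab0 en tE dE; rewrite /compatible /diagonals_of tE dE; split.
  move=> h; apply/negP => /andP[x y].
  have := h _ _ (set21 _ _) (set11 _); rewrite -addnA; apply: not_disjoint => //; lia.
have ne0 : (a != 0) || (b != n) by rewrite -negb_and -xpair_eqE.
move=> nc A B; rewrite !inE => /orP[]/eqP-> /eqP->; rewrite -!addnA; apply: disjoint_interiorsC.
  have [ea|ae] := leqP e a; first by apply: disjoint_inside; rewrite ?xpair_eqE; lia.
  have [be|eb] := leqP b e; last by move: nc; rewrite ae eb.
  have -> : diag (v + a) (v + b) = diag (v + (a + n.*2)) (v + (b + n.*2)).
    by apply: diag_congr; rewrite addnA modnDr.
  rewrite diagC.
  have -> : diag (v + (e + n)) (v + e) = diag (v + (e + n)) (v + (e + n.*2)).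
    by apply: diag_congr; rewrite // [in RHS]addnA modnDr.
  by apply: disjoint_inside; rewrite ?xpair_eqE; lia.
have [ea|ae] := leqP e a.
  rewrite diagC.
  have -> : diag (v + (e + n)) (v + e) = diag (v + (e + n)) (v + (e + n.*2)).
    by apply: diag_congr; rewrite // [in RHS]addnA modnDr.
  by apply: disjoint_inside; rewrite ?xpair_eqE; lia.
have [be|eb] := leqP b e; last by move: nc; rewrite ae eb.
by apply: disjoint_inside; rewrite ?xpair_eqE; lia.
Qed.

(** With its first end in the half-turn from [v], the diagonal crosses the diameter
    unless its second end is there too. *)
Lemma compatible_frame (t : diag_pair n) col (d : diameter n) v :
    val d = diag v (v + n) -> compatible R (inl t) (inr (col, d)) ->
  exists a b, [/\ (a + 2 <= b <= n)%N, (a, b) != (0, n)%N &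
    val t = pairset (v + a) (v + b)].
Proof.
move=> dE h; have [z [l [zn hl tE]]] := diag_pair_frame v t.
have [le|gt] := leqP (z + l) n.
  exists z, (z + l)%N; split; rewrite ?addnA //; first by lia.
  by rewrite xpair_eqE; lia.
have := h (diag (v + z) (v + z + l)) (val d); rewrite /diagonals_of tE !inE !eqxx.
move=> /(_ isT isT) /disjoint_interiorsC; rewrite dE -{1}(addn0 v) -addnA => /not_disjoint [] //; lia.
Qed.

Lemma pairset_inj v a b c d :
    (a < b <= n)%N -> (c < d <= n)%N -> (a, b) != (0, n)%N -> (c, d) != (0, n)%N ->
    pairset (v + a) (v + b) = pairset (v + c) (v + d) -> (a, b) = (c, d).
Proof.
move=> ab cd ab0 cd0 e.
have small x y : (x <= n)%N -> (y <= n)%N -> x = y %[mod n.*2] -> x = y.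
  by move=> xn yn; rewrite !modn_small //; lia.
have shift x y : (x <= n)%N -> (y <= n)%N -> x = y + n %[mod n.*2] ->
    x = (y + n)%N \/ x = 0%N /\ y = n.
  move=> xn yn; have [yn'|ny] := ltnP y n; first by rewrite !modn_small; [left|lia..].
  have -> : y = n by lia.
  by rewrite addnn modnn modn_small; [right|lia].
have modv x y : v + x = v + y %[mod n.*2] -> x = y %[mod n.*2].
  by move/eqP; rewrite eqn_modDl => /eqP.
have: diag (v + a) (v + b) \in pairset (v + c) (v + d) by rewrite -e set21.
have [an bn cn dn] : [/\ a <= n, b <= n, c <= n & d <= n]%N by split; lia.
rewrite !inE -!(addnA v) => /orP[]/eqP/diag_eq[][/modv h1 /modv h2].
- by rewrite (small _ _ an cn h1) (small _ _ bn dn h2).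
- have {}h1 := small _ _ an dn h1; have {}h2 := small _ _ bn cn h2.
  by move=> {small shift modv e}; lia.
- move: ab0 cd0; rewrite !xpair_eqE.
  have {}h1 := shift _ _ an cn h1; have {}h2 := shift _ _ bn dn h2.
  by move=> {small shift modv e}; case: h1 h2 => h1 [] h2; lia.
move: ab0 cd0; rewrite !xpair_eqE.
have {}h1 := shift _ _ an dn h1; have {}h2 := shift _ _ bn cn h2.
by move=> {small shift modv e}; case: h1 h2 => h1 [] h2; lia.
Qed.

(** A diameter through an endpoint of a longest diagonal of the family is crossed
    by no member: a diagonal crossing it, but neither the longest one nor its
    opposite, would enclose one of these and so be longer. *)
Lemma compatible_diameter_exists (T : {set diag_pair n}) (col : bool) :
    (forall t t', t \in T -> t' \in T -> t != t' -> compatible R (inl t) (inl t')) ->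
  exists d : diameter n, forall t, t \in T -> compatible R (inl t) (inr (col, d)).
Proof.
move=> cT; have [->|[t1 t1T]] := set_0Vmem T.
  by exists (axis 0) => t; rewrite inE.
have [f hf] := choice diag_pairP; have [g hg] := choice hf.
pose t0 := [arg max_(t > t1 in T) g t]%N.
have [t0T gmax] : t0 \in T /\ forall t, t \in T -> (g t <= g t0)%N.
  by rewrite /t0; case: arg_maxnP.
have [l0 t0E] := hg t0; move: (f t0) (g t0) l0 t0E gmax => v l hl t0E gmax.
exists (axis v) => t tT.
have [z [l' [zn hl' tE]]] := diag_pair_frame v t.
have lell : (l' <= l)%N.
  apply: leq_trans (gmax t tT); have [hgt tE'] := hg t.
  move: (f t) (g t) hgt tE' => a k hk; rewrite tE => e.
  have: diag (v + z) (v + z + l') \in pairset a (a + k) by rewrite -e set21.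
  rewrite !inE => /orP[]/eqP/diag_eq[][h1 h2].
  - move: h2; rewrite -modnDml h1 modnDml => {h1} /eqP.
    by rewrite eqn_modDl !modn_small; lia.
  - have : v + z + l' + k = v + z %[mod n.*2] by rewrite -modnDml h2 modnDml h1.
    by move=> {h1 h2} /eqP; rewrite -[X in _ == X %[mod _]]addn0 -addnA eqn_modDl !modn_small; lia.
  - move: h2; rewrite -modnDml h1 modnDml => {h1} /eqP.
    by rewrite (addnAC a n) eqn_modDr eqn_modDl !modn_small; lia.
  have : v + z + l' + k = v + z %[mod n.*2].
    by rewrite -modnDml h2 modnDml h1; congr modn; move=> {h1 h2}; lia.
  by move=> {h1 h2} /eqP; rewrite -[X in _ == X %[mod _]]addn0 -addnA eqn_modDl !modn_small; lia.
have [le|gt] := leqP (z + l') n.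
  apply/(@compatible_diameter t col _ v z (z + l') 0) => //=;
    rewrite ?addn0 ?tE ?addnA // ?xpair_eqE; lia.
have [tt0|ne] := eqVneq t t0.
  apply/(@compatible_diameter t col _ v 0 l 0) => //=; rewrite ?addn0 ?tt0 //; try lia.
  by rewrite xpair_eqE; lia.
have := cT _ _ tT t0T ne; rewrite /compatible /diagonals_of tE t0E.
move=> /(_ _ _ (set21 _ _) (set22 _ _)); rewrite -addnA -(addnA v l).
by move/not_disjoint => []; lia.
Qed.

End Labels.

(** * Cliques of facet labels *)

Lemma sum_subsets (A : finType) (K : comNzRingType) (x : K) (V : {set A}) :
  \sum_(S : {set A} | S \subset V) x ^+ #|S| = (1 + x) ^+ #|V|.
Proof.
have -> : (1 + x) ^+ #|V| = \prod_(i : A) ((if i \in V then x else 0) + 1).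
  rewrite -prodr_const big_mkcond; apply: eq_bigr => i _.
  by case: (i \in V); rewrite ?add0r 1?addrC.
rewrite bigA_distr big_mkcond; apply: eq_bigr => S _.
have [/fintype.subsetP SV|/fintype.subsetPn[i iS iV]] := boolP (S \subset V).
  rewrite -prodr_const big_mkcond; apply: eq_bigr => i _.
  by case: (boolP (i \in S)) => // /SV ->.
by rewrite (bigD1 i) //= iS (negbTE iV) mul0r.
Qed.

(** Families of labels are split into their diagonal pairs and their diameters. *)
Definition sum_set (A B : finType) (p : {set A} * {set B}) : {set A + B} :=
  [set x | match x with inl a => a \in p.1 | inr b => b \in p.2 end].

Definition set_sum (A B : finType) (C : {set A + B}) : {set A} * {set B} :=
  ([set a | inl a \in C], [set b | inr b \in C]).

Lemma sum_setK (A B : finType) : cancel (@sum_set A B) (@set_sum A B).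
Proof. by case=> T S; congr pair; apply/setP => x; rewrite !inE. Qed.

Lemma set_sumK (A B : finType) : cancel (@set_sum A B) (@sum_set A B).
Proof. by move=> C; apply/setP => -[x|x]; rewrite !inE. Qed.

Lemma card_sum_set (A B : finType) (T : {set A}) (S : {set B}) :
  #|sum_set (T, S)| = (#|T| + #|S|)%N.
Proof.
have -> : sum_set (T, S) = (@inl A B @: T) :|: (@inr A B @: S).
  apply/setP => -[x|x]; rewrite !inE /=.
    rewrite (mem_imset _ _ (@inl_inj A B)) orb_idr // => /imsetP[] //.
  by rewrite (mem_imset _ _ (@inr_inj A B)) orb_idl // => /imsetP[].
rewrite cardsU !card_imset; [|exact: inr_inj|exact: inl_inj].
rewrite (_ : _ :&: _ = finset.set0) ?cards0 ?subn0 //.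
by apply/setP => -[x|x]; rewrite !inE; apply/negbTE/negP;
  case/andP => /imsetP[a _ e1] /imsetP[b _ e2].
Qed.

(** Coloured diameters: a clique uses one colour only, or consists of both copies of
    a single diameter; the two monochromatic families share the empty set. *)
Lemma sum_bicoloured (A : finType) (V : {set A}) :
  \sum_(S : {set A} * {set A} | [&& S.1 \subset V, S.2 \subset V &
      [forall a in S.1, forall b in S.2, a == b]]) 'X ^+ (#|S.1| + #|S.2|)%N
  = diameter_weight #|V| :> {poly rat}.
Proof.
rewrite -(pair_big_dep (fun S : {set A} => S \subset V) (fun S S' : {set A} => (S' \subset V) &&
  [forall a in S, forall b in S', a == b]) (fun S S' : {set A} => 'X ^+ (#|S| + #|S'|)%N)) /=.
rewrite (bigD1 finset.set0) ?finset.sub0set //=.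
have -> : \sum_(S' : {set A} | (S' \subset V) && [forall a in finset.set0 : {set A}, forall b in S', a == b])
    'X ^+ (#|finset.set0 : {set A}| + #|S'|)%N = (1 + 'X) ^+ #|V| :> {poly rat}.
  rewrite -sum_subsets; apply: eq_big => [S|S _]; last by rewrite cards0.
  by apply: andb_idr => _; apply/forall_inP => a; rewrite inE.
have inner (S : {set A}) : (S \subset V) && (S != finset.set0) ->
    \sum_(S' : {set A} | (S' \subset V) && [forall a in S, forall b in S', a == b])
      'X ^+ (#|S| + #|S'|)%N = 'X ^+ #|S| + (if #|S| == 1%N then 'X^2 else 0) :> {poly rat}.
  move=> /andP[SV /set0Pn[a aS]].
  rewrite (bigD1 finset.set0) /=; last first.
    rewrite finset.sub0set; apply/forall_inP => b _; apply/forall_inP => c; by rewrite inE.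
  rewrite cards0 addn0; congr (_ + _).
  have single (S' : {set A}) : S' != finset.set0 -> [forall a in S, forall b in S', a == b] ->
      S = [set a] /\ S' = [set a].
    move=> /set0Pn[b bS'] /forall_inP h.
    have h' x y : x \in S -> y \in S' -> x = y by move=> /h/forall_inP h'' /h''/eqP.
    have ab := h' _ _ aS bS'; split; apply/setP => x; rewrite inE; apply/idP/eqP.
    - by move=> /h' /(_ bS'); rewrite -ab.
    - by move=> ->.
    - by move=> /(h' _ _ aS).
    by move=> ->; rewrite ab.
  have [/cards1P[c Sc]|nS] := boolP (#|S| == 1%N); last first.
    apply: big1 => S' /andP[/andP[_ h] S'0]; have [Sa _] := single _ S'0 h.
    by rewrite Sa cards1 in nS.
  rewrite (big_pred1 [set a]).
    by rewrite cards1 Sc cards1.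
  move=> S'; apply/idP/eqP => [/andP[/andP[_ h] S'0]|->]; first by case: (single _ S'0 h).
  have ac : a = c by move: aS; rewrite Sc inE => /eqP.
  rewrite finset.sub1set (fintype.subsetP SV) //=; apply/andP; split.
    by apply/forall_inP => x; rewrite Sc inE => /eqP ->; apply/forall_inP => y; rewrite inE ac eq_sym.
  by apply/set0Pn; exists a; rewrite inE.
rewrite (eq_bigr _ inner) big_split /= -big_mkcondr /=.
have -> : \sum_(S : {set A} | (S \subset V) && (S != finset.set0)) 'X ^+ #|S| = (1 + 'X) ^+ #|V| - 1 :> {poly rat}.
  by rewrite -sum_subsets [in RHS](bigD1 finset.set0) ?finset.sub0set //= cards0 expr0 [RHS]addrC addKr.
have -> : \sum_(S : {set A} | (S \subset V) && (S != finset.set0) && (#|S| == 1%N)) 'X^2 = 'X^2 *+ #|V| :> {poly rat}.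
  rewrite sumr_const; congr (_ *+ _).
  rewrite -(card_imset _ (@finset.set1_inj A)); apply: eq_card => S; rewrite unfold_in.
  apply/idP/imsetP => [/andP[/andP[SV _] /cards1P[a Sa]]|[a aV ->]].
    by exists a => //; move: SV; rewrite Sa finset.sub1set.
  rewrite finset.sub1set aV cards1 eqxx andbT /=; apply/set0Pn; exists a; by rewrite inE.
by rewrite /diameter_weight; ring.
Qed.

Section CliqueSum.
Variables (n : nat) (hn : (2 <= n)%N) (R : realType).

Local Notation pairset := (pairset hn).
Local Notation axis := (axis hn).
Local Notation arc := ('I_n.+1 * 'I_n.+1)%type.

Definition compatibleb (x y : facet_label n) : bool := `[< compatible R x y >].

Definition clique (C : {set facet_label n}) : bool :=
  [forall x in C, forall y in C, (x != y) ==> compatibleb x y].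

Definition diag_clique (T : {set diag_pair n}) : bool :=
  [forall t in T, forall t' in T, (t != t') ==> compatibleb (inl t) (inl t')].

Definition free_diameters (T : {set diag_pair n}) : {set diameter n} :=
  [set d | [forall t in T, compatibleb (inl t) (inr (true, d))]].

Lemma diag_cliqueP (T : {set diag_pair n}) : reflect
  (forall t t', t \in T -> t' \in T -> t != t' -> compatible R (inl t) (inl t'))
  (diag_clique T).
Proof.
apply: (iffP forall_inP) => [h t t' tT t'T ne|h t tT].
  by have := h t tT => /forall_inP/(_ t' t'T); rewrite ne => /asboolP.
by apply/forall_inP => t' t'T; apply/implyP => ne; apply/asboolP; apply: h.
Qed.

Lemma free_diametersP (T : {set diag_pair n}) col d : reflect
  (forall t, t \in T -> compatible R (inl t) (inr (col, d))) (d \in free_diameters T).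
Proof.
by rewrite inE; apply: (iffP forall_inP) => h t tT; apply/asboolP; apply: h.
Qed.

Lemma compatibleC (t : diag_pair n) col d :
  compatible R (inr (col, d)) (inl t) <-> compatible R (inl t) (inr (col, d)).
Proof.
by split => h A B hA hB; have := h B A hB hA; rewrite classical_sets.setIC.
Qed.

Lemma clique_sum_set (T : {set diag_pair n}) (D : {set bool * diameter n}) :
  clique (sum_set (T, D)) =
  [&& diag_clique T, [forall d in D, d.2 \in free_diameters T] &
    [forall d in D, forall d' in D, (d.1 == d'.1) || (d.2 == d'.2)]].
Proof.
apply/idP/and3P.
  move=> /forall_inP h.
  have inT t : t \in T -> inl t \in sum_set (T, D) by rewrite inE.
  have inD d : d \in D -> inr d \in sum_set (T, D) by rewrite inE.
  have h' x y : x \in sum_set (T, D) -> y \in sum_set (T, D) -> x != y -> compatible R x y.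
    by move=> hx hy ne; have := h x hx => /forall_inP/(_ y hy); rewrite ne => /asboolP.
  split.
  - by apply/diag_cliqueP => t t' tT t'T ne; apply: h'; rewrite ?inT.
  - apply/forall_inP => -[c d] dD; apply/(free_diametersP _ c) => t tT.
    by apply: h'; rewrite ?inT ?inD.
  apply/forall_inP => -[c d] dD; apply/forall_inP => -[c' d'] dD' /=.
  have [_|cc'] := eqVneq c c'; first by [].
  have ne : (inr (c, d) : facet_label n) != inr (c', d').
    by apply: contra cc' => /eqP[-> _].
  have [cc|->] := h' _ _ (inD _ dD) (inD _ dD') ne; last by rewrite eqxx.
  by rewrite cc eqxx in cc'.
move=> [/diag_cliqueP h1 /forall_inP h2 /forall_inP h3].
apply/forall_inP => x hx; apply/forall_inP => y hy; apply/implyP => ne; apply/asboolP.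
case: x y hx hy ne => [t|[c d]] [t'|[c' d']]; rewrite !inE => hx hy ne.
- exact: h1.
- by have /(free_diametersP _ c') := h2 _ hy; apply.
- by apply/compatibleC; have /(free_diametersP _ c) := h2 _ hx; apply.
by have /forall_inP/(_ _ hy)/orP[/eqP|/eqP] := h3 _ hx; [left|right].
Qed.

Definition colour_set (S : {set diameter n} * {set diameter n}) : {set bool * diameter n} :=
  [set d | d.2 \in (if d.1 then S.1 else S.2)].

Lemma clique_sum_split :
  \sum_(C : {set facet_label n} | clique C) 'X ^+ #|C| =
  \sum_(T : {set diag_pair n} | diag_clique T)
    'X ^+ #|T| * diameter_weight #|free_diameters T| :> {poly rat}.
Proof.
rewrite (reindex (@sum_set (diag_pair n) (bool * diameter n)%type)); last first.
  by exists (@set_sum _ _) => ? _; rewrite ?sum_setK ?set_sumK.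
rewrite (eq_big (fun p : {set diag_pair n} * {set bool * diameter n} => diag_clique p.1 &&
   ([forall d in p.2, d.2 \in free_diameters p.1] &&
    [forall d in p.2, forall d' in p.2, (d.1 == d'.1) || (d.2 == d'.2)]))
   (fun p => 'X ^+ #|p.1| * 'X ^+ #|p.2|)); first last.
- by move=> [T D] _; rewrite card_sum_set exprD.
- by move=> [T D]; rewrite clique_sum_set.
rewrite -(pair_big_dep diag_clique (fun (T : {set diag_pair n}) (D : {set bool * diameter n}) =>
    [forall d in D, d.2 \in free_diameters T] &&
    [forall d in D, forall d' in D, (d.1 == d'.1) || (d.2 == d'.2)])
   (fun (T : {set diag_pair n}) (D : {set bool * diameter n}) => 'X ^+ #|T| * 'X ^+ #|D|)) /=.
apply: eq_bigr => T _; rewrite -big_distrr /= -sum_bicoloured; congr (_ * _).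
pose split (D : {set bool * diameter n}) := ([set d | (true, d) \in D], [set d | (false, d) \in D]).
rewrite (reindex colour_set); last first.
  exists split => [[S1 S2] _|D _]; first by congr pair; apply/setP => d; rewrite !inE.
  by apply/setP => -[[] d]; rewrite !inE.
apply: eq_big => [[S1 S2]|[S1 S2] _] /=.
  apply/andP/and3P.
    move=> [/forall_inP h1 /forall_inP h2]; split.
    - by apply/fintype.subsetP => d dS; apply: (h1 (true, d)); rewrite inE.
    - by apply/fintype.subsetP => d dS; apply: (h1 (false, d)); rewrite inE.
    apply/forall_inP => a aS; apply/forall_inP => b bS.
    have /forall_inP/(_ (false, b)) := h2 (true, a) ltac:(by rewrite inE).
    by rewrite inE; apply.
  move=> [/fintype.subsetP s1 /fintype.subsetP s2 /forall_inP h]; split.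
    by apply/forall_inP => -[[] d]; rewrite inE /=; [apply: s1 | apply: s2].
  have h' a b : a \in S1 -> b \in S2 -> a == b by move=> aS; have /forall_inP := h a aS; apply.
  apply/forall_inP => -[[] a]; rewrite inE /= => aS;
  apply/forall_inP => -[[] b]; rewrite inE //= => bS; first exact: h'.
  by rewrite eq_sym; apply: h'.
congr (_ ^+ _).
have inj (c : bool) : injective (pair c : diameter n -> bool * diameter n).
  by move=> d d' [].
have -> : colour_set (S1, S2) = ((pair true) @: S1) :|: ((pair false) @: S2).
  apply/setP => -[[] d]; rewrite !inE /=.
    by rewrite (mem_imset _ _ (inj true)); apply/esym/orb_idr => /imsetP[].
  by rewrite (mem_imset _ _ (inj false)); apply/esym/orb_idl => /imsetP[].
rewrite cardsU !card_imset // (_ : _ :&: _ = finset.set0) ?cards0 ?subn0 //.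
apply/setP => -[c d]; rewrite !inE; apply/negbTE/negP.
by case/andP => /imsetP[a _ [-> _]] /imsetP[b _ []].
Qed.

(** The arc [(0, n)] is excluded: it would be the diameter itself. *)
Definition good_arc (p : arc) : bool :=
  (p.1 + 2 <= p.2 <= n)%N && ((p.1 : nat, p.2 : nat) != (0, n)%N).

Section Frame.
Variable v : nat.

(** The half-turn from [v] to [v + n] is read as the path [0, ..., n]. *)
Definition labels_of_arcs (Q : {set arc}) : {set diag_pair n} :=
  [set t | [exists p in Q, val t == pairset (v + p.1) (v + p.2)]].

Definition arcs_of_labels (T : {set diag_pair n}) : {set arc} :=
  [set p | good_arc p && [exists t in T, val t == pairset (v + p.1) (v + p.2)]].

Lemma labels_of_arcsP (Q : {set arc}) t : reflect
  (exists2 p, p \in Q & val t = pairset (v + p.1) (v + p.2)) (t \in labels_of_arcs Q).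
Proof.
rewrite inE; apply: (iffP exists_inP) => -[p pQ e]; exists p => //; exact/eqP.
Qed.

Lemma good_arcP (p : arc) : good_arc p ->
  [/\ (p.1 < p.2 <= n)%N, (p.1 + 2 <= p.2)%N & (p.1 : nat, p.2 : nat) != (0, n)%N].
Proof. by move=> /andP[h1 h2]; split => //; lia. Qed.

Lemma pairset_arc_inj (p q : arc) : good_arc p -> good_arc q ->
  pairset (v + p.1) (v + p.2) = pairset (v + q.1) (v + q.2) -> p = q.
Proof.
move=> /good_arcP[p1 _ p2] /good_arcP[q1 _ q2] e.
have [e1 e2] := pairset_inj p1 q1 p2 q2 e.
by case: p q e1 e2 {p1 p2 q1 q2 e} => [a b] [c d] /= e1 e2; congr pair; apply/val_inj.
Qed.

Lemma arc_label (p : arc) : good_arc p ->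
  exists t : diag_pair n, val t = pairset (v + p.1) (v + p.2).
Proof.
move=> /good_arcP[p1 p2 p3].
have h : is_diag_pair (pairset (v + p.1) (v + p.2)).
  rewrite (_ : v + p.2 = v + p.1 + (p.2 - p.1))%N; last by lia.
  by apply: pairset_is_diag_pair; move: p3; rewrite xpair_eqE; lia.
by exists (exist (@is_diag_pair n) _ h).
Qed.

Lemma labels_of_arcsK (Q : {set arc}) : (forall p, p \in Q -> good_arc p) ->
  arcs_of_labels (labels_of_arcs Q) = Q.
Proof.
move=> gQ; apply/setP => p; rewrite inE; apply/andP/idP.
  move=> [gp /exists_inP[t /labels_of_arcsP[q qQ ->] /eqP e]].
  by rewrite -(pairset_arc_inj (gQ _ qQ) gp e).
move=> pQ; split; first exact: gQ.
have [t tE] := arc_label (gQ p pQ); apply/exists_inP; exists t; last exact/eqP.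
by apply/labels_of_arcsP; exists p.
Qed.

Lemma arcs_of_labelsK (T : {set diag_pair n}) : axis v \in free_diameters T ->
  labels_of_arcs (arcs_of_labels T) = T.
Proof.
move=> /(free_diametersP _ true) fT; apply/setP => t; apply/labels_of_arcsP/idP.
  move=> [p]; rewrite inE => /andP[_ /exists_inP[t' t'T /eqP e]] e'.
  by rewrite (_ : t = t') //; apply/val_inj; rewrite /= e' e.
move=> tT; have [a [b [ab ab0 tE]]] := compatible_frame (erefl : val (axis v) = _) (fT t tT).
have an : (a < n.+1)%N by lia.
have bn : (b < n.+1)%N by lia.
exists (Ordinal an, Ordinal bn) => //; rewrite inE /good_arc /= ab ab0 /=.
by apply/exists_inP; exists t => //; apply/eqP.
Qed.

Lemma crossing_arc (p : arc) : ~~ crossing p.1 p.2 p.1 p.2.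
Proof. by rewrite /crossing; lia. Qed.

Lemma labels_of_arcs_dissection (Q : {set arc}) :
  (diag_clique (labels_of_arcs Q) && (axis v \in free_diameters (labels_of_arcs Q))) &&
    (arcs_of_labels (labels_of_arcs Q) == Q) =
  dissection n Q && ((ord0, ord_max) \notin Q).
Proof.
apply/idP/idP.
  move=> /andP[/andP[/diag_cliqueP cl _] /eqP e].
  have gQ p : p \in Q -> good_arc p by rewrite -{1}e inE => /andP[].
  apply/andP; split; last first.
    by apply/negP => /gQ /good_arcP[_ _]; rewrite /= eqxx.
  apply/dissectionP; split => [p /gQ /andP[] //|p q pQ qQ].
  have [->|pq] := eqVneq p q; first exact: crossing_arc.
  have [t tE] := arc_label (gQ p pQ); have [t' t'E] := arc_label (gQ q qQ).
  have ne : (p.1 : nat, p.2 : nat) != (q.1 : nat, q.2 : nat).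
    apply: contra pq => /eqP[e1 e2]; apply/eqP.
    by case: p q e1 e2 {pQ qQ tE t'E} => [a b] [c d] /= e1 e2; congr pair; apply/val_inj.
  have [p1 _ p2] := good_arcP (gQ p pQ); have [q1 _ q2] := good_arcP (gQ q qQ).
  apply/(compatible_diag R p1 q1 p2 q2 ne tE t'E); apply: cl.
  - by apply/labels_of_arcsP; exists p.
  - by apply/labels_of_arcsP; exists q.
  apply: contra pq => /eqP tt'; apply/eqP.
  by apply: pairset_arc_inj (gQ p pQ) (gQ q qQ) _; rewrite -tE -t'E tt'.
move=> /andP[/dissectionP[le nc] nQ].
have gQ p : p \in Q -> good_arc p.
  move=> pQ; rewrite /good_arc le //=; apply: contra nQ => /eqP[e1 e2].
  rewrite (_ : (ord0, ord_max) = p) //; case: p e1 e2 {pQ} => a b /= e1 e2.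
  by congr pair; apply/val_inj.
rewrite labels_of_arcsK // eqxx andbT; apply/andP; split.
  apply/diag_cliqueP => t t' /labels_of_arcsP[p pQ tE] /labels_of_arcsP[q qQ t'E] tt'.
  have [p1 _ p2] := good_arcP (gQ p pQ); have [q1 _ q2] := good_arcP (gQ q qQ).
  apply/(compatible_diag R p1 q1 p2 q2 _ tE t'E); last exact: nc.
  by apply: contra tt' => /eqP[e1 e2]; apply/eqP/val_inj; rewrite /= tE t'E e1 e2.
apply/(free_diametersP _ true) => t /labels_of_arcsP[p pQ tE].
have [p1 _ p2] := good_arcP (gQ p pQ).
by apply/(@compatible_diameter n hn R t true (axis v) v p.1 p.2 0);
  rewrite //= ?addn0 //; lia.
Qed.

Lemma card_labels_of_arcs (Q : {set arc}) : (forall p, p \in Q -> good_arc p) ->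
  #|labels_of_arcs Q| = #|Q|.
Proof.
move=> gQ; pose f (p : arc) : option (diag_pair n) := insub (pairset (v + p.1) (v + p.2)).
have fE p t : (f p == Some t) = (val t == pairset (v + p.1) (v + p.2)).
  rewrite /f; case: insubP => [u _ uE|nu].
    by rewrite -uE; apply/eqP/eqP => [[->]//|/val_inj ->].
  by apply/esym/negbTE; apply: contra nu => /eqP <-; apply: (valP t).
have Some_inj : injective (@Some (diag_pair n)) by move=> t t' [].
rewrite -(card_imset _ Some_inj) -(@card_in_imset _ _ f); last first.
  move=> p q pQ qQ; have [t tE] := arc_label (gQ p pQ).
  have /eqP -> : f p == Some t by rewrite fE tE.
  move=> /esym/eqP; rewrite fE tE => /eqP; apply: pairset_arc_inj; exact: gQ.
congr #|pred_of_set _|; apply/setP => o; apply/imsetP/imsetP => [[t /labels_of_arcsP[p pQ tE] ->]|[p pQ ->]].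
  by exists p => //; apply/esym/eqP; rewrite fE tE.
have [t tE] := arc_label (gQ p pQ); exists t; first by apply/labels_of_arcsP; exists p.
by apply/eqP; rewrite fE tE.
Qed.

Lemma axis_inj e e' : (e < n)%N -> (e' < n)%N -> axis (v + e) = axis (v + e') -> e = e'.
Proof.
move=> en en' /(congr1 val) /= /diag_eq[] [/eqP h _]; move: h.
  by rewrite eqn_modDl !modn_small; lia.
by rewrite -addnA eqn_modDl !modn_small; lia.
Qed.

Lemma free_labels_of_arcs (Q : {set arc}) : (forall p, p \in Q -> good_arc p) ->
  #|free_diameters (labels_of_arcs Q)| = #|visibles n Q|.
Proof.
move=> gQ; rewrite -(@card_in_imset _ _ (fun e : 'I_n.+1 => axis (v + e))); last first.
  move=> e e'; rewrite !inE => /andP[en _] /andP[en' _] /(axis_inj en en') ee.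
  exact/val_inj.
have iff e t p : (e < n)%N -> p \in Q -> val t = pairset (v + p.1) (v + p.2) ->
    compatible R (inl t) (inr (true, axis (v + e))) <-> ~~ ((p.1 < e) && (e < p.2))%N.
  move=> en pQ tE; have [p1 _ p2] := good_arcP (gQ p pQ).
  exact: (@compatible_diameter n hn R t true (axis (v + e)) v p.1 p.2 e).
congr #|pred_of_set _|; apply/setP => d; apply/(free_diametersP _ true)/imsetP.
  move=> fd; have [e en dE] := diameter_frame hn v d.
  have en' : (e < n.+1)%N by apply: ltnW.
  have dA : d = axis (v + e) by apply/val_inj.
  exists (Ordinal en') => //; rewrite inE en /=; apply/visibleP => p pQ.
  have [t tE] := arc_label (gQ p pQ); apply/(iff e t p en pQ tE); rewrite -dA.
  by apply: fd; apply/labels_of_arcsP; exists p.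
move=> [e]; rewrite inE => /andP[en /visibleP vis] -> t /labels_of_arcsP[p pQ tE].
by apply/(iff e t p en pQ tE); apply: vis.
Qed.

Lemma frame_sum (h : nat -> {poly rat}) :
  \sum_(T : {set diag_pair n} | diag_clique T && (axis v \in free_diameters T))
    'X ^+ #|T| * h #|free_diameters T| =
  \sum_(Q : {set arc} | dissection n Q && ((ord0, ord_max) \notin Q))
    'X ^+ #|Q| * h #|visibles n Q|.
Proof.
rewrite (reindex_onto labels_of_arcs arcs_of_labels) /=; last by move=> T /andP[_ /arcs_of_labelsK].
rewrite (eq_bigl _ _ labels_of_arcs_dissection); apply: eq_bigr => Q hQ.
have /eqP e : arcs_of_labels (labels_of_arcs Q) == Q.
  by move: hQ; rewrite -labels_of_arcs_dissection => /andP[].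
have gQ p : p \in Q -> good_arc p by rewrite -{1}e inE => /andP[].
by rewrite card_labels_of_arcs // free_labels_of_arcs.
Qed.

End Frame.

(** In a dissection without the arc (0, n), the right end of the longest arc issuing
    from 0 is visible (or the vertex 1, if there is no such arc). *)
Lemma visibles_eq1 (Q : {set arc}) : dissection n Q ->
  (#|visibles n Q| == 1%N) = ((ord0, ord_max) \in Q).
Proof.
move=> /dissectionP[le nc].
have v0 : (ord0 : 'I_n.+1) \in visibles n Q.
  by rewrite inE /=; apply/andP; split; [lia | apply/visibleP].
apply/idP/idP => [/cards1P[w wE]|inQ]; last first.
  apply/cards1P; exists ord0; apply/setP => e; rewrite inE; apply/idP/eqP => [|->//].
  rewrite inE => /andP[en /visibleP/(_ _ inQ)] /=; rewrite en andbT -leqNgt leqn0 => /eqP e0.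
  exact/val_inj.
have only e : (e < n)%N -> visible Q e -> e = 0%N.
  move=> en vis; have en' : (e < n.+1)%N by apply: ltnW.
  have : Ordinal en' \in visibles n Q by rewrite inE /= en.
  by move: v0; rewrite wE !inE => /eqP <- /eqP/(congr1 val).
have [p0 p0Q p00] : exists2 p, p \in Q & p.1 = 0%N :> nat.
  apply: contrapT => nex; suff : 1%N = 0%N by [].
  apply: only; first by lia.
  apply/visibleP => p pQ; apply/negP => h; apply: nex; exists p => //; lia.
pose P (p : arc) := (p \in Q) && (p.1 == 0%N :> nat).
have Pp0 : P p0 by rewrite /P p0Q p00.
pose q := [arg max_(p > p0 | P p) (p.2 : nat)]%N.
have [/andP[qQ /eqP q0] qmax] : P q /\ forall p, P p -> (p.2 <= q.2)%N.
  by rewrite /q; case: arg_maxnP.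
move: q qQ q0 qmax => q qQ q0 qmax.
have [q2|/only] := leqP n q.2.
  rewrite (_ : (ord0, ord_max) = q) //; case: q q0 q2 {qQ qmax} => a b /= a0 b2.
  by congr pair; apply/val_inj => //=; have := ltn_ord b; lia.
have := le q qQ; rewrite q0 => q2 vis; suff : visible Q q.2 by move=> /vis; lia.
apply/visibleP => p pQ; apply/negP => /andP[p1 p2].
have [p10|p10] := eqVneq (p.1 : nat) 0%N.
  by have := qmax p; rewrite /P pQ p10 leqNgt p2 => /(_ isT).
by have := nc q p qQ pQ; rewrite /crossing q0; lia.
Qed.

Lemma card_diameter : #|{: diameter n}| = n.
Proof.
rewrite -[RHS]card_ord -(@card_in_imset _ _ (fun e : 'I_n => axis (0 + e))); last first.
  by move=> e e' _ _ /axis_inj ee; apply/val_inj/ee.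
apply: eq_card => d; rewrite !inE; apply/esym/imsetP.
have [e en dE] := diameter_frame hn 0 d; exists (Ordinal en) => //; exact/val_inj.
Qed.

(** Each clique of diagonal pairs is counted once for every diameter it leaves
    free, with its weight divided by their number. For a fixed diameter the sum runs
    over path dissections without the arc [(0, n)], which are those with more than
    one visible vertex: hence the value [h 1 = 0]. *)
Theorem clique_sum :
  \sum_(C : {set facet_label n} | clique C) 'X ^+ #|C| =
  \sum_(2 <= v < n.+1) dissection_poly n v * diameter_weight v :> {poly rat}.
Proof.
pose g (c : nat) : {poly rat} := (c%:R^-1)%:P * diameter_weight c.
pose h (c : nat) : {poly rat} := if c == 1%N then 0 else g c.
have cg c : (0 < c)%N -> c%:R * g c = diameter_weight c.
  move=> c0; rewrite /g mulrA -polyC_natr -polyCM mulfV ?mul1r //.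
  by rewrite pnatr_eq0 -lt0n.
rewrite clique_sum_split.
transitivity (\sum_(T : {set diag_pair n} | diag_clique T) \sum_(d in free_diameters T)
    'X ^+ #|T| * g #|free_diameters T|).
  apply: eq_bigr => T cT; rewrite sumr_const -mulr_natl mulrCA cg //.
  have [d fd] := compatible_diameter_exists hn true (diag_cliqueP T cT).
  by apply/card_gt0P; exists d; apply/(free_diametersP _ true).
rewrite (exchange_big_dep predT) //=.
transitivity (\sum_(d : diameter n) iter n.-1 (transfer 'X) h 1).
  apply: eq_bigr => d _; have [v _ dE] := diameter_frame hn 0 d.
  have -> : d = axis (0 + v) by apply/val_inj.
  rewrite frame_sum -(@dissection_sum _ 'X n h); last by lia.
  rewrite [RHS](bigID (fun Q : {set arc} => (ord0, ord_max) \in Q)) /=.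
  rewrite [X in _ = X + _]big1 ?add0r => [|Q /andP[dQ]]; last first.
    by rewrite -visibles_eq1 // /h => ->; rewrite mulr0.
  by apply: eq_bigr => Q /andP[dQ]; rewrite -visibles_eq1 // /h => /negbTE ->.
rewrite sumr_const card_diameter -mulr_natl iter_transfer; last by lia.
rewrite [LHS]big_ltn; last by lia.
have h1 : h 1%N = 0 by [].
rewrite h1 mulr0 add0r big_nat [RHS]big_nat; apply: eq_bigr => v /andP[v2 _].
rewrite /h gtn_eqF // [v%:R * _]mulrC -mulrA cg //; lia.
Qed.

Theorem card_cliques k :
  #|[set C : {set facet_label n} | (#|C| == k) && clique C]|%:R = clique_count n k.
Proof.
rewrite /clique_count -clique_sum coef_sum -sum1_card natr_sum big_mkcond [RHS]big_mkcond /=.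
apply: eq_bigr => C _; rewrite inE coefXn eq_sym.
by case: (clique C); case: eqP.
Qed.

End CliqueSum.

(** * The gamma-vector *)

Section CoefficientIdentity.
Variables (K : comNzRingType) (t : K).

(** The coefficient of [X^n] in its [n]-th power is the sum of the [C(n, k)^2 t^k], the
    h-polynomial of type B; that of [X^(n - 1)] is [n] times the Narayana polynomial,
    which stems from type A. *)
Definition central_poly : {poly K} := (1 + 'X) * (t%:P + 'X).

(** Expand [central_poly = (t - 1) (1 + X) + (1 + X)^2]. *)
Lemma coef_central_binomial m q : (central_poly ^+ m)`_q =
  \sum_(j < m.+1) ('C(m, j) * 'C(m + j, q))%:R * (t - 1) ^+ (m - j).
Proof.
have -> : central_poly = ((t - 1)%:P * (1 + 'X)) + (1 + 'X) ^+ 2.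
  by rewrite /central_poly rmorphB /=; ring.
rewrite exprDn coef_sum; apply: eq_bigr => j _.
rewrite exprMn -rmorphXn /= -exprM -mulrA -exprD coefMn coefCM coef_1DXn.
have -> : (m - j + 2 * j = m + j)%N by have := ltn_ord j; lia.
by rewrite natrM -mulr_natl; ring.
Qed.

Lemma coef_X2DC j e : (('X^2 + t%:P) ^+ j)`_e =
  if odd e then 0 else 'C(j, e./2)%:R * t ^+ (j - e./2).
Proof.
rewrite addrC exprDn coef_sum.
under eq_bigr => i _ do rewrite -rmorphXn /= -exprM coefMn coefCM coefXn.
have ne (i : 'I_j.+1) : e != (2 * i)%N ->
    t ^+ (j - i) * (e == (2 * i)%N)%:R *+ 'C(j, i) = 0.
  by move=> /negbTE ->; rewrite mulr0 mul0rn.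
have [oe|/negbTE oe] := boolP (odd e).
  by apply: big1 => i _; apply: ne; apply: contraTneq oe => ->; rewrite mul2n odd_double.
have e2 : e = (2 * e./2)%N by rewrite mul2n -[LHS]odd_double_half oe.
have [lt|ge] := ltnP e./2 j.+1; last first.
  rewrite bin_small ?mul0r // big1 // => i _; apply: ne.
  by have := ltn_ord i; lia.
rewrite (bigD1 (Ordinal lt)) //= big1 => [|i ie]; last first.
  by apply: ne; move: ie; rewrite -val_eqE /=; lia.
by rewrite -e2 eqxx mulr1 addr0 [RHS]mulr_natl.
Qed.

(** Expand [central_poly = (1 + t) X + (X^2 + t)]. *)
Lemma coef_central_gamma m q : (q <= m)%N -> (central_poly ^+ m)`_q =
  \sum_(j < m.+1 | (m - q <= j)%N && ~~ odd (j - (m - q)))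
    ('C(m, j) * 'C(j, (j - (m - q))./2))%:R * (1 + t) ^+ (m - j)
      * t ^+ (j - (j - (m - q))./2).
Proof.
move=> qm; have -> : central_poly = (1 + t)%:P * 'X + ('X^2 + t%:P).
  by rewrite /central_poly rmorphD /=; ring.
rewrite exprDn coef_sum [RHS]big_mkcond; apply: eq_bigr => j _.
rewrite exprMn -rmorphXn /= -mulrA coefMn coefCM coefXnM.
have jm : (j <= m)%N by rewrite -ltnS.
have -> : (q < m - j)%N = ~~ (m - q <= j)%N by lia.
case: leqP => /= [le|]; last by rewrite mulr0 mul0rn.
have -> : (q - (m - j) = j - (m - q))%N by lia.
rewrite coef_X2DC; case: ifP => _ /=; first by rewrite mulr0 mul0rn.
by rewrite natrM -mulr_natl; ring.
Qed.

Lemma sum_even (F : nat -> K) n :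
  \sum_(j < n.+1 | ~~ odd j) F j = \sum_(i < (n./2).+1) F i.*2.
Proof.
rewrite big_mkcond; elim: n => [|n IH]; first by rewrite !big_ord1.
rewrite big_ord_recr /= IH uphalf_half; have [on|en] := boolP (odd n).
  by rewrite add1n [RHS]big_ord_recr /=; congr (_ + F _); lia.
by rewrite addr0.
Qed.

End CoefficientIdentity.

Lemma coef_central_diag (K : comNzRingType) (t : K) m :
  (central_poly t ^+ m)`_m = \sum_(i < (m./2).+1)
    ('C(m, i.*2) * 'C(i.*2, i))%:R * (t ^+ i * (1 + t) ^+ (m - i.*2)).
Proof.
rewrite coef_central_gamma // subnn.
pose F j : K := ('C(m, j) * 'C(j, j./2))%:R * (t ^+ (j./2) * (1 + t) ^+ (m - j)).
rewrite (eq_big (fun j : 'I_m.+1 => ~~ odd j) (fun j : 'I_m.+1 => F j)).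
- by rewrite sum_even; apply: eq_bigr => i _; rewrite /F doubleK.
- by move=> j; rewrite subn0.
move=> j; rewrite /= subn0 => ej; rewrite /F -mulrA [X in _ * X]mulrC.
by congr (_ * (_ ^+ _ * _)); have := odd_double_half j; lia.
Qed.

Lemma coef_central_subdiag (K : comNzRingType) (t : K) m :
  (central_poly t ^+ m.+1)`_m = \sum_(i < (m.+2./2).+1)
    (if (i : nat) is i'.+1 then 'C(m.+1, (i'.*2).+1) * 'C((i'.*2).+1, i') else 0)%:R *
      (t ^+ i * (1 + t) ^+ (m.+2 - i.*2)).
Proof.
rewrite coef_central_gamma // subSnn.
pose F j : K := if j is j'.+1 then
  ('C(m.+1, j') * 'C(j', j'./2))%:R * (t ^+ (j' - j'./2) * (1 + t) ^+ (m.+1 - j')) else 0.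
have -> : \sum_(i < (m.+2./2).+1)
    (if (i : nat) is i'.+1 then 'C(m.+1, (i'.*2).+1) * 'C((i'.*2).+1, i') else 0)%:R *
      (t ^+ i * (1 + t) ^+ (m.+2 - i.*2)) = \sum_(i < (m.+2./2).+1) F i.*2.
  apply: eq_bigr => -[[|i] iN] _; first by rewrite /= mul0r.
  rewrite /F /= uphalf_double doubleS !subSS; congr (_ * (_ ^+ _ * _)); lia.
rewrite -sum_even big_mkcond [RHS]big_mkcond [RHS]big_ord_recl /= add0r.
apply: eq_bigr => j _; rewrite /= add0n negbK.
case: j => -[|j] jm /=; first by [].
rewrite subSS subn0; case: (boolP (odd j)) => oj //=.
have e : (uphalf j = j./2) by rewrite uphalf_half (negbTE oj).
by rewrite e -mulrA [X in _ * X]mulrC.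
Qed.

(** This is [(n - 1 - i) / (n - 1) * n! / (i! i! (n - 2 i)!)]. The subtracted term is written
    with the Catalan number [C(2j, j) - C(2j, j + 1)], [j = i - 1], so as to be an
    integer without division. *)
Definition gamma_D (n i : nat) : int :=
  ('C(n, i.*2) * 'C(i.*2, i))%:R -
  (if i is j.+1 then (n * 'C(n.-2, j.*2))%:R * ('C(j.*2, j)%:R - 'C(j.*2, j.+1)%:R) else 0).

Lemma bin_double_succ j :
  ('C((j.*2).+1, j))%:R = (j.*2).+1%:R * ('C(j.*2, j)%:R - 'C(j.*2, j.+1)%:R) :> int.
Proof.
have nz : j.+1%:R != 0 :> int by rewrite pnatr_eq0.
have e1 : (j.+1 * 'C((j.*2).+1, j) = (j.*2).+1 * 'C(j.*2, j))%N.
  rewrite -(@bin_sub _ j); last by lia.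
  have -> : ((j.*2).+1 - j = j.+1)%N by lia.
  by rewrite -mul_bin_diag.
have e2 : (j.+1 * 'C(j.*2, j.+1) = j * 'C(j.*2, j))%N.
  by rewrite mul_bin_left; congr (_ * _)%N; lia.
apply: (mulfI nz); rewrite [RHS]mulrCA mulrBr -!natrM e1 e2 natrM.
by rewrite -natrB ?leq_mul2r ?leqnSn ?orbT // -mulnBl subSnn mul1n.
Qed.

Lemma gamma_D_scaled n i : n.+1%:R * gamma_D n.+2 i =
  n.+1%:R * ('C(n.+2, i.*2) * 'C(i.*2, i))%:R - n.+2%:R *
  (if i is i'.+1 then 'C(n.+1, (i'.*2).+1) * 'C((i'.*2).+1, i') else 0)%:R.
Proof.
case: i => [|i]; rewrite /gamma_D mulrBr. rewrite /= mulr0n !mulr0. by rewrite !subr0.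
congr (_ - _) => /=; rewrite !natrM bin_double_succ !mulrA; congr (_ * _).
rewrite -!mulrA -!natrM; congr _%:R.
have := mul_bin_diag n.+1 (i.*2); rewrite /= => e.
by rewrite mulnCA e; lia.
Qed.

Lemma gamma_D_ge0 n i : (i <= n.+2./2)%N -> 0 <= gamma_D n.+2 i.
Proof.
move=> le; have n0 : 0 < n.+1%:R :> int by rewrite ltr0n.
rewrite -(pmulr_rge0 _ n0) gamma_D_scaled -!natrM subr_ge0 ler_nat.
case: i le => [|i] le; first by rewrite muln0.
have e1 := mul_bin_diag n.+2 (i.*2).+1; have e2 := mul_bin_diag (i.+1).*2 i.
rewrite /= in e1 e2.
rewrite mulnA e1 -doubleS [(_ * 'C(n.+2, _))%N]mulnC -mulnA e2 mulnCA.
rewrite leq_mul2r; apply/orP; right; lia.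
Qed.

(** Multiplied by [n - 1], the left-hand side is a combination of the diagonal
    coefficient of the [n]-th power of [central_poly] and of the subdiagonal one of its
    [(n - 1)]-th power, where [n] stands for [n.+2]. *)
Theorem gamma_expansion n (f : nat -> int) :
    (forall k, (k <= n.+2)%N -> n.+1%:R * f k =
      'C(n.+2, k)%:R * (n.+1%:R * 'C(n.+2 + k, k)%:R - k%:R * 'C(n + k, k)%:R)) ->
  \sum_(i < n.+3) f (n.+2 - i)%N *: ('X - 1) ^+ i =
  \sum_(i < (n.+2./2).+1) gamma_D n.+2 i *: ('X^i * (1 + 'X) ^+ (n.+2 - i.*2)) :> {poly int}.
Proof.
move=> hf; have nz : n.+1%:R != 0 :> {poly int} by rewrite -polyC_natr polyC_eq0 pnatr_eq0.
apply: (mulfI nz).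
have sc (c : int) (p : {poly int}) : n.+1%:R * (c *: p) = (n.+1%:R * c) *: p.
  by rewrite -mul_polyC mulrA -polyC_natr -polyCM mul_polyC.
have natZ (k : nat) (p : {poly int}) : (k%:R : int) *: p = k%:R * p.
  by rewrite scaler_nat mulr_natl.
rewrite !big_distrr /=.
under [RHS]eq_bigr do rewrite sc gamma_D_scaled scalerBl -!scalerA !natZ.
rewrite sumrB -[X in _ = X - _]big_distrr -[X in _ = _ - X]big_distrr /=.
rewrite -(coef_central_diag 'X n.+2) -(coef_central_subdiag 'X n).
rewrite (reindex_inj rev_ord_inj) /= !coef_central_binomial.
have e k : (k <= n.+2)%N -> n.+1%:R * (f k *: ('X - 1) ^+ (n.+2 - k)) =
    n.+1%:R * (('C(n.+2, k) * 'C(n.+2 + k, n.+2))%:R * ('X - 1) ^+ (n.+2 - k)) -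
    (k * 'C(n.+2, k) * 'C(n + k, n))%:R * ('X - 1) ^+ (n.+2 - k) :> {poly int}.
  move=> kn; rewrite sc hf // mulrBr scalerBl mulrCA -!natZ scalerA -!natrM.
  congr (_ *: _ - _ *: _); congr _%:R.
    by rewrite -(bin_sub (leq_addr k n.+2)) addKn mulnA.
  by rewrite -(bin_sub (leq_addr k n)) addKn; lia.
rewrite (eq_bigr (fun k : 'I_n.+3 =>
    n.+1%:R * (('C(n.+2, k) * 'C(n.+2 + k, n.+2))%:R * ('X - 1) ^+ (n.+2 - k)) -
    (k * 'C(n.+2, k) * 'C(n + k, n))%:R * ('X - 1) ^+ (n.+2 - k))); last first.
  move=> k _; have kn : (k <= n.+2)%N by rewrite -ltnS.
  by rewrite subSS subKn // e.
rewrite sumrB -big_distrr /=; congr (_ - _).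
rewrite big_ord_recl /= !mul0n mul0r add0r big_distrr /=.
apply: eq_bigr => j _; rewrite /bump /= add1n -mul_bin_diag /= mulrA -natrM mulnA addSnnS.
by rewrite !subSS.
Qed.

(** The lowest-order term of each summand determines its coefficient. *)
Lemma gamma_unique n (g g' : nat -> int) :
    \sum_(i < (n./2).+1) g i *: ('X^i * (1 + 'X) ^+ (n - i.*2)) =
    \sum_(i < (n./2).+1) g' i *: ('X^i * (1 + 'X) ^+ (n - i.*2)) :> {poly int} ->
  forall i, (i <= n./2)%N -> g i = g' i.
Proof.
move=> e i; have [k ik] := ubnP i; elim: k i ik => // k IH i; rewrite ltnS => ik iN.
have cf (h : nat -> int) : (\sum_(i < (n./2).+1) h i *: ('X^i * (1 + 'X) ^+ (n - i.*2)) : {poly int})`_i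
    = \sum_(j < i) h j * 'C(n - j.*2, i - j)%:R + h i.
  rewrite coef_sum -(big_mkord xpredT (fun j => (h j *: ('X^j * (1 + 'X) ^+ (n - j.*2)) : {poly int})`_i)).
  have term j : (h j *: ('X^j * (1 + 'X) ^+ (n - j.*2)) : {poly int})`_i =
      if (i < j)%N then 0 else h j * 'C(n - j.*2, i - j)%:R.
    rewrite coefZ coefXnM; case: ifP => _; first by rewrite mulr0.
    by rewrite coef_1DXn.
  rewrite (@big_cat_nat _ _ _ i.+1) //=.
  rewrite [X in _ + X]big_nat_cond [X in _ + X]big1 ?addr0; last first.
    by move=> j; rewrite andbT => /andP[ij _]; rewrite term ij.
  rewrite big_nat_recr //= term ltnn subnn bin0 mulr1 big_mkord; congr (_ + _).
  by apply: eq_bigr => j _; rewrite term ltnNge ltnW.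
have := congr1 (fun p : {poly int} => p`_i) e; rewrite /= !cf.
rewrite (eq_bigr (fun j : 'I_i => g' j * 'C(n - j.*2, i - j)%:R)); first exact: addrI.
move=> j _; congr (_ * _); apply: IH; first exact: leq_trans (ltn_ord j) ik.
by apply: leq_trans iN; apply: ltnW.
Qed.

(** * The generalized associahedron *)

Section TypeD.
Local Open Scope classical_set_scope.

(** The flag property provides the common point of pairwise intersecting facets; the
    empty family corresponds to [P] itself. *)
Lemma fnum_cliques (R : realType) (m n : nat) (P : set 'rV[R]_m) (i : nat) :
    type_D_associahedron n P -> (i <= n)%N ->
  fnum P i = #|[set C : {set facet_label n} | (#|C| == n - i)%N && clique R C]%SET|.
Proof.
move=> [[simP flagP] [phi [iphi rphi cphi]]] le.
rewrite (fnum_simple simP iphi rphi le).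
have fphi x : facet P (phi x) by rewrite -rphi; exists x.
congr #|pred_of_set _|; apply/setP => C; rewrite !inE; congr (_ && _).
apply/asboolP/forall_inP => [[z [_ hz]] x xC|cl].
  apply/forall_inP => y yC; apply/implyP => /eqP xy; apply/asboolP.
  by apply/(cphi x y xy); exists z; split; apply: hz.
have [z hz] : (\bigcap_(F in phi @` [set` C]) F) !=set0.
  apply: flagP => [F [x _ <-]//|F G [x xC <-] [y yC <-]].
  have [<-|xy] := eqVneq x y; first by rewrite classical_sets.setIid; case: (fphi x) => -[].
  apply/(cphi x y); first exact/eqP.
  by have /forall_inP/(_ y yC) := cl x xC; rewrite xy => /asboolP.
have hz' x : x \in C -> phi x z by move=> xC; apply: hz; exists x.
have [C0|[x xC]] := set_0Vmem C; last first.
  exists z; split => [|y yC]; last exact: hz'.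
  have [[_ [c [d [_ E]]]] _] := fphi x.
  by have := hz' x xC; rewrite E => -[].
have [_ [z' [_ [z'P _ _ _]]] _] := simP.
by exists z'; split => // y /=; rewrite C0 inE.
Qed.

End TypeD.

Theorem corollary1 (R : realType) (m n : nat) (P : set 'rV[R]_m)
    (hn : (2 <= n)%N) (hP : type_D_associahedron n P) :
  exists gamma : {ffun 'I_(n./2).+1 -> int},
    [/\ gamma_numbers n P gamma,
        forall gamma', gamma_numbers n P gamma' -> gamma' = gamma &
        forall i, 0 <= gamma i].
Proof.
pose f (k : nat) : int :=
  #|[set C : {set facet_label n} | (#|C| == k)%N && clique R C]%SET|%:R.
have hE : hpoly n P = \sum_(i < n.+1) f (n - i)%N *: ('X - 1) ^+ i.
  rewrite /hpoly /fpoly raddf_sum /=; apply: eq_bigr => i _.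
  rewrite comp_polyZ comp_Xn_poly (fnum_cliques hP); last by rewrite -ltnS.
  by rewrite /f natz.
have fE k : (f k)%:~R = clique_count n k.
  by rewrite -(card_cliques hn R k) rmorph_nat.
case: n hn P hP f hE fE => [|[|n]] // hn P hP f hE fE.
have expansion : hpoly n.+2 P = \sum_(i < (n.+2./2).+1)
    gamma_D n.+2 i *: ('X^i * (1 + 'X) ^+ (n.+2 - i.*2)).
  rewrite hE; apply: gamma_expansion => k _; apply: (@intr_inj rat).
  by rewrite !rmorphM rmorphB !rmorphM /= fE !rmorph_nat clique_count_closed.
exists [ffun i : 'I_(n.+2./2).+1 => gamma_D n.+2 i]; split.
- by rewrite /gamma_numbers expansion; apply: eq_bigr => i _; rewrite ffunE.
- move=> g gE; apply/ffunP => i; rewrite ffunE.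
  have := @gamma_unique n.+2 (fun j => g (inord j)) (gamma_D n.+2).
  rewrite -expansion gE => h.
  rewrite -(h _ i) ?inord_val //; last by rewrite -ltnS.
  by apply: eq_bigr => j _; rewrite inord_val.
by move=> i; rewrite ffunE; apply: gamma_D_ge0; rewrite -ltnS.
Qed.
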